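(* Locally Rainbow Path can be solved in $r^{\mathcal{O}(r+k)}\cdot \ell n^2 m$ time, where $n$ and $m$ are the numbers of vertices and arcs of the input digraph, $\ell$ is the length bound of the desired path and $k:=\ell-\operatorname{dist}(s,t)$ is its detour length.
   Context: Digraphs have no self-loops. A path of length $q$ is a sequence $(v_0,\dots,v_q)$ of pairwise distinct vertices with $(v_{i-1},v_i)$ an arc for all $i\in\{1,\dots,q\}$. $\operatorname{dist}(s,t)$ is the length of a shortest $s$-$t$ path. For a vertex coloring $c$, a path $(v_0,\dots,v_q)$ is $r$-rainbow if for every $i\in\{0,\dots,q-r\}$ the vertices $v_i,\dots,v_{i+r}$ have pairwise different colors. Locally Rainbow Path: given a digraph $G$, a vertex coloring $c\colon V(G)\to C$, distinct vertices $s,t$, and integers $r,\ell\ge 0$, decide whether there is an $r$-rainbow $s$-$t$ path of length at most $\ell$ in $G$. Standing assumption: the input digraph is weakly connected. *)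

(* Defs.v *)
(* MathComp *)
From mathcomp Require Import all_boot.

Set Implicit Arguments.
Unset Strict Implicit.
Unset Printing Implicit Defensive.

Record digraph := Digraph {
  nvert : nat;
  arrow : rel 'I_nvert;
  arrow_irreflexive : irreflexive arrow }.

Section Digraph.
Variable G : digraph.
Notation V := 'I_(nvert G).

Definition arcs : {set V * V} := [set a | arrow a.1 a.2].

Definition weakly_connected : Prop :=
  forall x y : V, connect (fun u v => arrow u v || arrow v u) x y.

(* The path is x :: p, so its length is size p. *)
Definition dipath (x y : V) (p : seq V) : bool :=
  [&& path (@arrow G) x p, last x p == y & uniq (x :: p)].

Definition has_dipath (x y : V) (q : nat) : bool :=
  [exists p : q.-tuple V, dipath x y p].

(* None stands for an infinite distance.  Since the vertices of a path are
   distinct, only lengths smaller than nvert G need to be considered. *)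
Definition dist (x y : V) : option V :=
  [pick d : V | has_dipath x y d & [forall e : V, has_dipath x y e ==> (d <= e)]].

(* An instance with l < dist s t (in particular with dist s t infinite) has no
   solution, hence no detour; its detour length is set to 0. *)
Definition detour (s t : V) (l : nat) : nat :=
  if dist s t is Some d then l - d else 0.

(* For the path (v_0, ..., v_q) given by the sequence vs of its q + 1 vertices,
   the indices i in {0, ..., q - r} are those with i + r < size vs; there are
   none if q < r. *)
Definition rainbow (c : V -> nat) (r : nat) (vs : seq V) : Prop :=
  forall i : nat, i + r < size vs -> uniq (map c (take r.+1 (drop i vs))).

Definition locally_rainbow_path
    (c : V -> nat) (s t : V) (r l : nat) : Prop :=
  exists p : seq V, [/\ dipath s t p, rainbow c r (s :: p) & size p <= l].

End Digraph.

(* Deterministic random access machines under the uniform cost measure, with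
   structured control flow.  The only arithmetic operations are addition and
   truncated subtraction (no multiplication, division or bit operations), so
   that unit costs are not abused on large numbers.  The memory consists of
   registers and of arrays that can be addressed indirectly.  Register and
   array names are constants of the program, so a program uses finitely many of
   them, and interleaving its arrays in one memory gives an ordinary RAM with
   only constant-factor overhead. *)
Inductive expr :=
  | Const of nat
  | Reg of nat
  | Get of nat & expr
  | Add of expr & expr
  | Sub of expr & expr.

Inductive program :=
  | Skip
  | SetReg of nat & expr
  | SetArr of nat & expr & expr
  | Seq of program & program
  | If of expr & program & program
  | While of expr & program.

Record state := State {
  reg : nat -> nat;
  arr : nat -> nat -> nat }.

Definition set_reg (st : state) (x v : nat) : state :=
  State (fun y => if y == x then v else reg st y) (arr st).

Definition set_arr (st : state) (a i v : nat) : state :=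
  State (reg st)
        (fun b j => if (b == a) && (j == i) then v else arr st b j).

Fixpoint eval (st : state) (e : expr) : nat :=
  match e with
  | Const k => k
  | Reg x => reg st x
  | Get a e1 => arr st a (eval st e1)
  | Add e1 e2 => eval st e1 + eval st e2
  | Sub e1 e2 => eval st e1 - eval st e2
  end.

Fixpoint cost (e : expr) : nat :=
  match e with
  | Const _ | Reg _ => 1
  | Get _ e1 => (cost e1).+1
  | Add e1 e2 | Sub e1 e2 => (cost e1 + cost e2).+1
  end.

(* exec P st st' T: started in st, P halts in st' after T time units.
   A condition holds if its value is nonzero. *)
Inductive exec : program -> state -> state -> nat -> Prop :=
  | ExecSkip st : exec Skip st st 1
  | ExecSetReg st x e :
      exec (SetReg x e) st (set_reg st x (eval st e)) (cost e).+1
  | ExecSetArr st a e1 e2 :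
      exec (SetArr a e1 e2) st
           (set_arr st a (eval st e1) (eval st e2)) (cost e1 + cost e2).+1
  | ExecSeq P Q st st1 st2 T1 T2 :
      exec P st st1 T1 -> exec Q st1 st2 T2 ->
      exec (Seq P Q) st st2 (T1 + T2)
  | ExecIfTrue e P Q st st1 T :
      eval st e != 0 -> exec P st st1 T ->
      exec (If e P Q) st st1 (cost e + T).+1
  | ExecIfFalse e P Q st st1 T :
      eval st e = 0 -> exec Q st st1 T ->
      exec (If e P Q) st st1 (cost e + T).+1
  | ExecWhileTrue e P st st1 st2 T1 T2 :
      eval st e != 0 -> exec P st st1 T1 -> exec (While e P) st1 st2 T2 ->
      exec (While e P) st st2 (cost e + T1 + T2).+1
  | ExecWhileFalse e P st :
      eval st e = 0 -> exec (While e P) st st (cost e).+1.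

(* As the arcs may be listed in any order, lists_arcs does not determine A. *)
Definition lists_arcs (G : digraph) (A : seq ('I_(nvert G) * 'I_(nvert G))) :
    Prop :=
  uniq A /\ A =i arcs G.

(* Registers 0 to 5 hold n, m, s, t, r and l; arrays 0 and 1 hold the tails and
   heads of the arcs, array 2 the colors; everything else is zero. *)
Definition input (G : digraph) (A : seq ('I_(nvert G) * 'I_(nvert G)))
    (c : 'I_(nvert G) -> nat) (s t : 'I_(nvert G)) (r l : nat) : state :=
  State (nth 0 [:: nvert G; size A; val s; val t; r; l])
        (fun a => match a with
                  | 0 => nth 0 [seq val a.1 | a <- A]
                  | 1 => nth 0 [seq val a.2 | a <- A]
                  | 2 => nth 0 [seq c v | v <- enum 'I_(nvert G)]
                  | _ => fun=> 0
                  end).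

Definition accepting (st : state) : Prop := reg st 0 = 1.
Definition rejecting (st : state) : Prop := reg st 0 = 0.

(* Main.v *)
Require Import Defs.
From Stdlib Require Import FunctionalExtensionality.
From mathcomp Require Import all_boot all_order all_algebra.
From mathcomp Require Import zify ring.
Import Defs.

(* Let d = dist(s,t).  If d < r, a shortest path is rainbow, so assume r <= d.
   Removing a closed subwalk from an s-t walk leaves an s-t walk, hence the
   repeated vertices of a walk of length at most l are at most l - d steps
   apart.  So it suffices to find a walk whose windows of r + 1 vertices are
   colorful and whose windows of K + 1 vertices are repetition free, where
   K = l - d, and K = 0 if r <= 1.

   Whether a walk with last vertices h_0, h_1, ... (backwards) can be continued
   by b_0, b_1, ... only depends on the nonvanishing modulo a prime p > n + 1 of
     prod_(i + j < r) (col b_j - col h_i) * prod_(i, j < K) (b_j - h_i).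
   As a polynomial in the b_j, symmetric in the second factor, it is determined
   by its values at r^O(r + K) points, so it is a fixed linear functional of
   the vector of these values.  Dynamic programming over the length and the
   last vertex therefore may keep only walks whose vectors are linearly
   independent; dependent ones are discarded by Gaussian elimination modulo p.
   Multiplication modulo p is done by repeated addition in time O(p), and a
   prime p = O(n^2) exists because all prime powers dividing C(2N, N) are at
   most 2N.  Since n = O(m), sieving for it in time O(n^3) is affordable. *)

Set Implicit Arguments.
Unset Strict Implicit.
Unset Printing Implicit Defensive.
Import GRing.Theory.

(** * Running programs *)

(** The windows only ask for b_j != h_i with i + j < K, but that product is not symmetric in the
    b_j: interpolating them separately would take (K + 1)! points, too many when K is much larger
    than r. The full square i, j < K is symmetric, so multisets of K points from 0, ..., K suffice,
    and 2K binary digits encode them. The price is a test that asks for more than the windows do.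
    Solutions still pass it, because a whole s-t walk of length at most l with repetition-free
    windows has no repetition at all. The color factor is not symmetric, but it has only r variables
    of degree at most r, hence (r + 1)^r points. For r <= 1 the time bound leaves no room for a
    dependence on K; this forces K = 0 there, and the correctness proof cuts cycles out of the walk
    found. Inequalities must survive reduction modulo p: colors are renamed to vertices, histories
    are padded with n and continuations with n + 1, so all numbers compared are at most n + 1 <
    p. *)

Fixpoint wreg (P : program) : seq nat :=
  match P with
  | Skip | SetArr _ _ _ => [::]
  | SetReg x _ => [:: x]
  | Seq P Q | If _ P Q => wreg P ++ wreg Q
  | While _ P => wreg P
  end.

Fixpoint warr (P : program) : seq nat :=
  match P with
  | Skip | SetReg _ _ => [::]
  | SetArr a _ _ => [:: a]
  | Seq P Q | If _ P Q => warr P ++ warr Q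
  | While _ P => warr P
  end.

(** A syntactic frame condition: loop invariants mention only what the loop changes, and everything
    else is recovered from the program text. *)
Definition agree (P : program) (st st' : state) : Prop :=
  (forall x, x \notin wreg P -> reg st' x = reg st x) /\
  (forall a, a \notin warr P -> arr st' a = arr st a).

Lemma agree_refl P st : agree P st st.
Proof. by split. Qed.

Lemma agree_trans P st st1 st2 :
  agree P st st1 -> agree P st1 st2 -> agree P st st2.
Proof.
move=> [r1 a1] [r2 a2]; split=> x nx; first by rewrite r2 // r1.
by rewrite a2 // a1.
Qed.

Lemma agree_sub P Q st st' :
  {subset wreg P <= wreg Q} -> {subset warr P <= warr Q} ->
  agree P st st' -> agree Q st st'.
Proof.
move=> sr sa [r1 a1]; split=> x nx; first by apply/r1/(contra (sr x)).
exact/a1/(contra (sa x)).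
Qed.

Lemma exec_agree P st st' T : exec P st st' T -> agree P st st'.
Proof.
elim=> {P st st' T} /=.
- exact: agree_refl.
- by move=> st x e; split=> //= y; rewrite inE => /negPf ->.
- move=> st a e1 e2; split=> //= b; rewrite inE => /negPf nb.
  by apply: functional_extensionality => j; rewrite nb.
- move=> P Q st st1 st2 T1 T2 _ ag1 _ ag2; apply: (agree_trans (st1 := st1)).
  + by apply: agree_sub ag1 => x /=; rewrite mem_cat => ->.
  + by apply: agree_sub ag2 => x /=; rewrite mem_cat => ->; rewrite orbT.
- by move=> e P Q st st1 T _ _ ag; apply: agree_sub ag => x /=;
    rewrite mem_cat => ->.
- by move=> e P Q st st1 T _ _ ag; apply: agree_sub ag => x /=;
    rewrite mem_cat => ->; rewrite orbT.
- by move=> e P st st1 st2 T1 T2 _ _ ag1 _ ag2; apply: (agree_trans ag1).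
- by move=> *; apply: agree_refl.
Qed.

Definition wp (P : program) (st : state) (Q : state -> nat -> Prop) : Prop :=
  exists st' T, exec P st st' T /\ Q st' T.

Lemma wp_conseq P st (Q Q' : state -> nat -> Prop) :
  wp P st Q -> (forall st' T, agree P st st' -> Q st' T -> Q' st' T) ->
  wp P st Q'.
Proof.
move=> [st' [T [ex q]]] QQ'; exists st', T; split=> //.
exact: QQ' (exec_agree ex) q.
Qed.

Lemma wp_skip st (Q : state -> nat -> Prop) : Q st 1 -> wp Skip st Q.
Proof. by exists st, 1; split=> //; constructor. Qed.

Lemma wp_set x e st (Q : state -> nat -> Prop) :
  Q (set_reg st x (eval st e)) (cost e).+1 -> wp (SetReg x e) st Q.
Proof. by move=> q; do 2!eexists; split; first constructor. Qed.

Lemma wp_arr a e1 e2 st (Q : state -> nat -> Prop) :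
  Q (set_arr st a (eval st e1) (eval st e2)) (cost e1 + cost e2).+1 ->
  wp (SetArr a e1 e2) st Q.
Proof. by move=> q; do 2!eexists; split; first constructor. Qed.

Lemma wp_seq P P' st (Q : state -> nat -> Prop) :
  wp P st (fun st1 T1 => wp P' st1 (fun st2 T2 => Q st2 (T1 + T2))) ->
  wp (Seq P P') st Q.
Proof.
move=> [st1 [T1 [ex1 [st2 [T2 [ex2 q]]]]]]; exists st2, (T1 + T2).
by split=> //; apply: ExecSeq ex1 ex2.
Qed.

Lemma wp_if e P P' st (Q : state -> nat -> Prop) :
  (eval st e != 0 -> wp P st (fun st1 T => Q st1 (cost e + T).+1)) ->
  (eval st e = 0 -> wp P' st (fun st1 T => Q st1 (cost e + T).+1)) ->
  wp (If e P P') st Q.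
Proof.
move=> w1 w2; have [e0|e1] := eqVneq (eval st e) 0.
  have [st1 [T [ex q]]] := w2 e0.
  by exists st1, (cost e + T).+1; split=> //; apply: ExecIfFalse.
have [st1 [T [ex q]]] := w1 e1.
by exists st1, (cost e + T).+1; split=> //; apply: ExecIfTrue.
Qed.

Definition For (x : nat) (e : expr) (body : program) : program :=
  Seq (SetReg x (Const 0))
    (While (Sub e (Reg x)) (Seq body (SetReg x (Add (Reg x) (Const 1))))).

Fixpoint stable (e : expr) (xs as_ : seq nat) : bool :=
  match e with
  | Const _ => true
  | Reg x => x \notin xs
  | Get a e1 => (a \notin as_) && stable e1 xs as_
  | Add e1 e2 | Sub e1 e2 => stable e1 xs as_ && stable e2 xs as_
  end.

Lemma eval_agree P st st' e :
  agree P st st' -> stable e (wreg P) (warr P) -> eval st' e = eval st e.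
Proof.
move=> [r1 a1]; elim: e => /= [k|x|a e IH|e1 IH1 e2 IH2|e1 IH1 e2 IH2].
- by []. - exact: r1.
- by case/andP=> na /IH ->; rewrite a1.
- by case/andP=> /IH1 -> /IH2 ->.
- by case/andP=> /IH1 -> /IH2 ->.
Qed.

(** [B] bounds the body alone. The 7 is the overhead of a round besides [cost e]: 3 for the loop
    test and 4 for the increment. [I] is required after the increment of the counter. *)
Lemma wp_for x e body st N B (I : nat -> state -> Prop)
    (Q : state -> nat -> Prop) :
  x \notin wreg body -> stable e (wreg (For x e body)) (warr (For x e body)) ->
  eval st e = N ->
  I 0 (set_reg st x 0) ->
  (forall j st1, j < N -> agree (For x e body) st st1 -> reg st1 x = j ->
     I j st1 ->
     wp body st1 (fun st2 T => T <= B /\ I j.+1 (set_reg st2 x j.+1))) ->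
  (forall st2 T, agree (For x e body) st st2 -> reg st2 x = N -> I N st2 ->
     T <= N * (B + cost e + 7) + cost e + 5 -> Q st2 T) ->
  wp (For x e body) st Q.
Proof.
move=> nx se eN I0 step fin.
have loop k : forall st1, k <= N -> agree (For x e body) st st1 ->
    reg st1 x = N - k -> I (N - k) st1 ->
    exists st2 T, [/\ exec (While (Sub e (Reg x))
        (Seq body (SetReg x (Add (Reg x) (Const 1))))) st1 st2 T,
      reg st2 x = N, I N st2 & T <= k * (B + cost e + 7) + cost e + 3].
  elim: k => [|k IH] st1 kN ag rx Ik.
    exists st1, (cost (Sub e (Reg x))).+1; split; rewrite ?subn0 // in rx Ik *.
      by apply: ExecWhileFalse; rewrite /= (eval_agree ag) // eN rx subnn.
    by rewrite /=; lia.
  have [|st2 [T [ex [TB I2]]]] := step _ st1 _ ag rx Ik; first lia.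
  have ag2 := exec_agree ex.
  have r2 : reg st2 x = N - k.+1 by rewrite ag2.1.
  set st3 := set_reg st2 x (N - k.+1).+1 in I2.
  have Ek : (N - k.+1).+1 = N - k by lia.
  rewrite Ek in st3 I2.
  have ag3 : agree (For x e body) st st3.
    apply: (agree_trans ag); apply: (agree_trans (st1 := st2)).
      by apply: agree_sub ag2 => y yb /=; rewrite ?inE ?mem_cat yb ?orbT.
    by split=> //= y; rewrite inE => /norP[/negPf -> _].
  have [||st4 [T' [ex' rx' IN TB']]] := IH st3 _ ag3 _ I2; try lia.
    by rewrite /= eqxx.
  exists st4, (cost (Sub e (Reg x)) + (T + 4) + T').+1; split=> //; last first.
    by rewrite mulSn /=; lia.
  apply: ExecWhileTrue ex'.
    by rewrite /= (eval_agree ag) // eN rx; lia.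
  apply: (ExecSeq ex).
  suff -> : st3 = set_reg st2 x (eval st2 (Add (Reg x) (Const 1))).
    exact: ExecSetReg.
  by rewrite /st3 /= r2; congr set_reg; lia.
have ag0 : agree (For x e body) st (set_reg st x 0).
  by split=> //= y; rewrite inE => /norP[/negPf -> _].
have [||st2 [T [ex rx IN TB]]] := loop N (set_reg st x 0) (leqnn N) ag0.
- by rewrite /= eqxx subnn.
- by rewrite subnn.
have ex2 : exec (For x e body) st st2 (2 + T).
  by apply: ExecSeq ex; apply: ExecSetReg.
exists st2, (2 + T); split=> //.
by apply: fin => //; [apply: exec_agree ex2|lia].
Qed.

(** * A prime number of quadratic size *)

(** Termwise comparison of Vandermonde's sum with the expansion of (1 + 1)^N. *)
Lemma expn2_le_bin N : 2 ^ N <= 'C(N + N, N).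
Proof.
rewrite -binomial.Vandermonde -[2]/(1 + 1) expnDn; apply: leq_sum => i _.
rewrite !exp1n !muln1 leq_pmulr // bin_gt0; lia.
Qed.

(** By Legendre's formula the exponent of p is the sum over k of floor(2N / p^k) - 2 floor(N / p^k).
    Each term is at most 1 and vanishes once p^k > 2N, so the exponent is at most [L]. *)
Lemma pfactor_bin_le p N : prime p -> 0 < N ->
  p ^ logn p 'C(N + N, N) <= N + N.
Proof.
move=> pp N0; have p1 := prime_gt1 pp.
set B := 'C(_, _); set L := trunc_log p (N + N).
have /andP[Ll Lu] : p ^ L <= N + N < p ^ L.+1.
  by apply: trunc_log_bounds => //; lia.
apply: leq_trans Ll; rewrite leq_exp2l //.
have lf := @logn_fact p.
have e : logn p B + (logn p N`! + logn p N`!) = logn p (N + N)`!.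
  rewrite -!lognM ?muln_gt0 ?fact_gt0 ?bin_gt0 ?leq_addr //.
  by congr (logn p _); rewrite -(bin_fact (leq_addr N N)) addKn.
(* Terms with k > a vanish since then p^k > a. This gives the sums for N and for 2N a common
   range. *)
have w a : \sum_(1 <= k < a.+1) a %/ p ^ k =
            \sum_(1 <= k < (a + N).+1) a %/ p ^ k.
  rewrite (big_cat_nat (n := a.+1) (p := (a + N).+1)) //=; last by lia.
  rewrite [X in _ = _ + X]big_nat_cond [X in _ = _ + X]big1 ?addn0 //.
  move=> k /andP[/andP[h _] _].
  by rewrite divn_small //; apply: ltn_trans h (ltn_expl k p1).
suff : logn p (N + N)`! <= L + (logn p N`! + logn p N`!) by lia.
rewrite !lf // [X in _ + (X + X)]w -big_split /=.
have LN : L <= N + N.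
  by apply: ltnW (leq_trans (ltn_expl L p1) _); apply: trunc_logP; lia.
have -> : L = \sum_(1 <= k < (N + N).+1 | k <= L) 1.
  rewrite big_mkcond (big_cat_nat (n := L.+1)) //= [X in _ + X]big_nat_cond.
  rewrite [X in _ + X]big1; last by move=> k /andP[/andP[h _] _]; rewrite leqNgt h.
  rewrite addn0 (eq_big_nat _ _ (F2 := fun=> 1)).
    by rewrite sum_nat_const_nat muln1 subn1.
  by move=> k /andP[_]; rewrite ltnS => ->.
rewrite [X in _ <= X + _]big_mkcond -big_split /=; apply: leq_sum => k _.
have pk0 : 0 < p ^ k by rewrite expn_gt0 prime_gt0.
case: (leqP k L) => kL.
  have := divn_eq N (p ^ k); have := ltn_pmod N pk0.
  have := divn_eq (N + N) (p ^ k).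
  move: (N %/ _) (N %% _) ((N + N) %/ _) ((N + N) %% _) => a b c d.
  by nia.
rewrite divn_small //; apply: leq_trans Lu _.
by rewrite leq_exp2l.
Qed.

Lemma prime_dvd_fact p m : prime p -> p %| m`! -> p <= m.
Proof.
move=> pp; elim: m => [|m IH]; first by rewrite fact0 dvdn1; case: eqP pp => // ->.
by rewrite factS Euclid_dvdM // => /orP[/dvdn_leq-> //|/IH/leqW].
Qed.

(** Without such a prime, the primes dividing C(2N, N) lie among 2, ..., n + 1, and n prime powers
    of size at most 2N give 2^N <= (2N)^n. The choice N = 8 n^2 turns this into 2^(8n) <= 16 n^2,
    which is false. *)
Lemma prime_window n : 1 < n ->
  exists q, [/\ prime q, n.+1 < q & q <= 16 * n ^ 2].
Proof.
move=> n1; have [N Nn] : exists N, N = 8 * n ^ 2 by eexists.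
have N0 : 0 < N by rewrite Nn muln_gt0 expn_gt0; lia.
case: (boolP [exists q : 'I_(16 * n ^ 2).+1, prime q && (n.+1 < q)]).
  case/existsP=> q /andP[qp nq]; exists (val q); split=> //.
  exact: (ltn_ord q).
move=> /existsPn noq.
have small q : prime q -> q %| 'C(N + N, N) -> q < n.+2.
  move=> qp qd; rewrite ltnNge; apply/negP => nq.
  have qN : q <= N + N.
    by apply: (prime_dvd_fact qp); rewrite -(bin_fact (leq_addr N N)) dvdn_mulr.
  have q16 : q < (16 * n ^ 2).+1 by rewrite ltnS; move: qN; rewrite Nn; lia.
  by have := noq (Ordinal q16); rewrite qp nq.
have C0 : 0 < 'C(N + N, N) by rewrite bin_gt0 leq_addr.
have le : 'C(N + N, N) <= (N + N) ^ n.
  rewrite -[X in X <= _](@part_pnat_id [pred q | q < n.+2]); last first.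
    by apply/pnatP => // q qp qd; exact: small.
  rewrite (@widen_partn (n.+2 + 'C(N + N, N))) ?leq_addl // big_mkcond /=.
  rewrite (big_cat_nat (n := n.+2)) //=; last by lia.
  rewrite [X in _ * X]big_nat_cond [X in _ * X]big1 ?muln1; last first.
    move=> q /andP[/andP[h _] _]; case: ifP => // qn.
    by move: qn h; rewrite inE; lia.
  rewrite (big_cat_nat (n := 2)) //= big_ltn // big_nat1 /=.
  rewrite [logn 0 _]lognE [logn 1 _]lognE /= !mul1n.
  have -> : (N + N) ^ n = \prod_(2 <= q < n.+2) (N + N).
    by rewrite prod_nat_const_nat !subSS subn0.
  apply: leq_prod => q _; case: ifP => // _; last by rewrite addn_gt0 N0.
  case: (boolP (prime q)) => qp; first exact: pfactor_bin_le.
  by rewrite lognE (negPf qp) addn_gt0 N0.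
have := leq_trans (expn2_le_bin N) le.
have -> : 2 ^ N = (2 ^ (8 * n)) ^ n.
  by rewrite -expnM; congr (2 ^ _); rewrite Nn; lia.
rewrite leq_exp2r; last exact: ltnW.
suff : N + N < 2 ^ (8 * n) by rewrite ltnNge => /negPf ->.
have -> : N + N = 2 ^ 4 * n ^ 2 by rewrite Nn; lia.
apply: (@leq_trans (2 ^ 4 * (2 ^ n) ^ 2)); last first.
  by rewrite -expnM -expnD leq_exp2l //; lia.
by rewrite ltn_pmul2l ?expn_gt0 // ltn_exp2r // ltn_expl.
Qed.

(** * Linear functionals on evaluation vectors *)

Section Residues.
Variable p : nat.
Hypothesis pp : prime p.

Lemma Fp_natr_eq a b : ((a%:R == b%:R :> 'F_p) = (a == b %[mod p]))%R.
Proof. by rewrite -val_eqE /= !val_Fp_nat. Qed.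

Lemma Fp_natr_inj a b : a < p -> b < p -> (a%:R = b%:R :> 'F_p)%R -> a = b.
Proof. by move=> ap bp /eqP; rewrite Fp_natr_eq !modn_small // => /eqP. Qed.

Lemma Fp_natr_val (x : 'F_p) : ((val x)%:R = x)%R.
Proof. exact: natr_Zp. Qed.

Lemma Fp_val_lt (x : 'F_p) : val x < p.
Proof. by have := ltn_ord x; rewrite {2}(Fp_cast pp). Qed.

Lemma Fp_natr_modn a : ((a %% p)%:R = a%:R :> 'F_p)%R.
Proof. by apply/eqP; rewrite Fp_natr_eq modn_mod. Qed.

Lemma Fp_natrB a : a <= p -> ((p - a)%:R = - a%:R :> 'F_p)%R.
Proof.
move=> ap; rewrite natrB //; suff -> : (p%:R = 0 :> 'F_p)%R by rewrite sub0r.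
by apply/eqP; rewrite (Fp_natr_eq p 0) modnn mod0n.
Qed.

Lemma interpolation N (b : 'F_p) : exists L : nat -> 'F_p,
  forall g : {poly 'F_p}, size g <= N ->
    (g.[b] = \sum_(x < N) L x * g.[x%:R])%R.
Proof.
(* With at least p nodes, [b] is itself a node. Otherwise the nodes 0, ..., N - 1 are distinct
   modulo p and Lagrange interpolation applies. *)
have [pN|Np] := leqP p N.
  exists (fun x => (x == val b)%:R)%R => g _.
  have bN : val b < N by apply: leq_trans (Fp_val_lt b) pN.
  rewrite (bigD1 (Ordinal bN)) //= eqxx mul1r Fp_natr_val big1 ?addr0 //.
  by move=> i; rewrite -val_eqE /= => /negPf ->; rewrite mul0r.
have [->|N0] := posnP N.
  exists (fun=> 0)%R => g; rewrite leqn0 size_poly_eq0 => /eqP ->.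
  by rewrite horner0 big_ord0.
pose q (x : nat) : {poly 'F_p} :=
  (\prod_(z < N | val z != x) ('X - (val z)%:R%:P))%R.
exists (fun x => ((q x).[x%:R])^-1 * (q x).[b])%R => g gN.
pose d := (g - \sum_(x < N) (g.[(val x)%:R] / (q x).[(val x)%:R]) *: q x)%R.
have qx (x z : 'I_N) : (((q x).[(val z)%:R] == 0) = (z != x))%R.
  rewrite /q horner_prod; apply/idP/idP => [/prodf_eq0[y yx]|zx].
    rewrite !hornerE subr_eq0 => /eqP/Fp_natr_inj zy.
    by rewrite -val_eqE /= zy //; apply: (ltn_trans (ltn_ord _) Np).
  by apply/prodf_eq0; exists z; rewrite // !hornerE subrr.
have d0 : d = 0%R.
  apply: (@roots_geq_poly_eq0 _ d [seq (val z)%:R%R | z <- enum 'I_N]).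
  - apply/allP => _ /mapP[z _ ->]; rewrite rootE /d !hornerE horner_sum.
    rewrite (bigD1 z) //= !hornerE divfK ?qx ?eqxx // big1 ?addr0 ?subrr //.
    move=> y yz; rewrite !hornerE.
    by have /eqP -> : (q y).[(val z)%:R]%R == 0%R; rewrite ?mulr0 // qx eq_sym.
  - rewrite map_inj_in_uniq ?enum_uniq // => y z _ _ /Fp_natr_inj yz.
    by apply: val_inj; apply: yz; apply: (ltn_trans (ltn_ord _) Np).
  - rewrite size_map size_enum_ord /d (leq_trans (size_polyD _ _)) // geq_max gN.
    rewrite size_polyN; apply/(leq_trans (size_sum _ _ _))/bigmax_leqP => x _.
    apply: leq_trans (size_scale_leq _ _) _.
    rewrite /q -big_filter size_prod_XsubC.
    suff -> : size [seq z <- index_enum 'I_N | val z != val x] = N.-1 by lia.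
    rewrite -[in RHS](card_ord N) -(cardC1 x) cardE; apply/perm_size/uniq_perm.
    + by rewrite filter_uniq // index_enum_uniq.
    + exact: enum_uniq.
    + by move=> z; rewrite [RHS]mem_enum [LHS]mem_filter mem_index_enum andbT.
have : g = (d + \sum_(x < N) (g.[(val x)%:R] / (q x).[(val x)%:R]) *: q x)%R.
  by rewrite /d subrK.
rewrite d0 add0r => {1}->; rewrite horner_sum; apply: eq_bigr => x _.
by rewrite !hornerE -mulrA mulrC.
Qed.
End Residues.

Lemma digits_onto R len (dg : nat -> nat) :
  (forall j, j < len -> dg j < R) ->
  exists2 x, x < R ^ len & forall j, j < len -> (x %/ R ^ j) %% R = dg j.
Proof.
elim: len dg => [|len IH] dg dgR; first by exists 0.
have [|x xR xdg] := IH (fun j => dg j.+1); first by move=> j /(dgR j.+1).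
have R0 : 0 < R by apply: leq_ltn_trans (dgR 0 _).
have d0 := dgR 0 isT.
exists (x * R + dg 0) => [|[|j] jl].
- by rewrite expnS; nia.
- by rewrite expn0 divn1 modnMDl modn_small.
- by rewrite expnS divnMA divnMDl // (divn_small d0) addn0 xdg.
Qed.

Section Tests.
Variables (p r K : nat) (cl : nat -> nat).
Hypothesis pp : prime p.
Local Notation F := 'F_p.
Implicit Type h : nat -> nat.

Definition digit (x j : nat) : nat := (x %/ r.+1 ^ j) %% r.+1.

Definition color_factor h (j : nat) (x : F) : F :=
  (\prod_(i < r - j) (x - (cl (h i))%:R))%R.

Definition vertex_factor h (x : F) : F := (\prod_(i < K) (x - (h i)%:R))%R.

Definition ystep (f : nat -> F) (a : nat * F) (d : nat) : nat * F :=
  if d == 0 then (a.1.+1, a.2) else (a.1, a.2 * f a.1)%R.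

Definition yrun h (ds : seq nat) : nat * F :=
  foldl (ystep (fun y => vertex_factor h y%:R%R)) (0, 1%R) ds.

(* The first r digits are the evaluation points for the colors of the next r
   vertices.  The remaining 2K digits spell a nondecreasing sequence of at most
   2K evaluation points for the next vertices: the digit 0 increments the
   current point, any other digit emits it. *)
Definition phi h (x : nat) : F :=
  ((\prod_(j < r) color_factor h j (digit x j)%:R) *
   (yrun h (mkseq (fun j => digit x (r + j)) (K + K))).2)%R.

(** Induction from the right: the code of the prefix stops at the last point y, the digit 1 emits y,
    and Y - y zeros advance to Y. The code does not depend on [h]. *)
Lemma yrun_onto (ys : seq nat) Y : sorted leq ys -> all (fun y => y <= Y) ys ->
  exists ds : seq nat, [/\ size ds = size ys + Y, all (fun d => d <= 1) ds &
    forall h, yrun h ds = (Y, \prod_(y <- ys) vertex_factor h y%:R)%R].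
Proof.
elim/last_ind: ys Y => [|ys y IH] Y.
  move=> _ _; exists (nseq Y 0); split; first by rewrite size_nseq.
    by rewrite all_nseq orbT.
  move=> h; rewrite big_nil /yrun; elim: Y => // Y {}IH.
  by rewrite -{1}[Y.+1]addn1 nseqD foldl_cat IH.
rewrite all_rcons => sy /andP[yY _].
have sy' : sorted leq ys by move: sy; rewrite -cats1 => /cat_sorted2[].
have ly : all (fun z => z <= y) ys.
  have := sy; rewrite -cats1 sorted_pairwise; last exact: leq_trans.
  rewrite pairwise_cat => /andP[/allP al _]; apply/allP => z zs.
  by have := al z zs; rewrite /= andbT.
have [ds [sd ad yd]] := IH y sy' ly.
exists (rcons ds 1 ++ nseq (Y - y) 0); split.
- by rewrite size_cat size_rcons size_nseq sd size_rcons; lia.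
- by rewrite all_cat all_rcons all_nseq ad !orbT.
move=> h; rewrite /yrun foldl_cat foldl_rcons -/(yrun h ds) yd /=.
rewrite -cats1 big_cat big_seq1 /= /ystep /=.
set P := (_ * _)%R; rewrite -[in RHS](subnKC yY).
elim: (Y - y) => [|k {}IH]; first by rewrite addn0.
by rewrite -{1}[k.+1]addn1 nseqD foldl_cat IH addnS.
Qed.

Variable N : nat.
Hypothesis RN : r.+1 ^ (r + (K + K)) <= N.
Hypothesis r0K : 0 < K -> 0 < r.

(** The coefficients do not depend on [h]; therefore a linear dependence between vectors of
    histories carries over to their values under [A]. *)
Definition Lin (A : (nat -> nat) -> F) : Prop :=
  exists w : nat -> F, forall h, (A h = \sum_(x < N) w x * phi h x)%R.

Lemma Lin_sum m (c : nat -> F) (A : nat -> (nat -> nat) -> F) :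
  (forall i, i < m -> Lin (A i)) -> Lin (fun h => \sum_(i < m) c i * A i h)%R.
Proof.
elim: m => [|m IH] LA.
  exists (fun=> 0%R) => h; rewrite big_ord0 big1 // => i _; exact: mul0r.
have [|w wE] := IH; first by move=> i im; apply: LA; apply: leqW.
have [v vE] := LA m (leqnn _).
exists (fun x => w x + c m * v x)%R => h; rewrite big_ord_recr /= wE vE.
rewrite big_distrr -big_split /=; apply: eq_bigr => x _.
by rewrite mulrDl mulrA.
Qed.

Definition Mix (xs : nat -> F) (ys : seq F) h : F :=
  ((\prod_(j < r) color_factor h j (xs j)) * \prod_(y <- ys) vertex_factor h y)%R.

Lemma Lin_ext A B : (forall h, A h = B h) -> Lin A -> Lin B.
Proof. by move=> AB [w wE]; exists w => h; rewrite -AB. Qed.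

(** The product over [zs] is symmetric, so [zs] may be sorted before it is spelled with digits 0 and
    1. The digit 1 exists in base r + 1 only if r > 0, hence [r0K]. *)
Lemma Lin_grid (xs ys : nat -> nat) (zs : seq nat) :
  (forall j, j < r -> xs j <= r) -> size zs = K -> all (fun y => y <= K) zs ->
  Lin (Mix (fun j => (xs j)%:R%R) [seq y%:R%R | y <- zs]).
Proof.
move=> xr sz az.
have [||ds [sd ad dE]] := @yrun_onto (sort leq zs) K.
- exact: (sort_sorted leq_total).
- by rewrite all_sort.
rewrite size_sort sz in sd.
have [j jl|x xR xE] := @digits_onto r.+1 (r + (K + K))
    (fun j => if j < r then xs j else nth 0 ds (j - r)).
  case: ifP => jr; first by rewrite ltnS xr.
  have K0 : 0 < K by lia.
  have ir : j - r < size ds by rewrite sd; lia.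
  have := allP ad _ (mem_nth 0 ir); have := r0K K0 => /=; lia.
exists (fun y => (y == x)%:R)%R => h.
have xN : x < N by apply: leq_trans RN.
rewrite (bigD1 (Ordinal xN)) //= eqxx mul1r big1 ?addr0; last first.
  by move=> i; rewrite -val_eqE /= => /negPf ->; rewrite mul0r.
rewrite /Mix /phi; congr (_ * _)%R.
  apply: eq_bigr => j _; congr (color_factor _ _ _%:R%R).
  by rewrite /digit xE ?ltn_ord // ltn_addr.
suff -> : mkseq (fun j => digit x (r + j)) (K + K) = ds.
  by rewrite dE big_map; apply: perm_big; rewrite perm_sym perm_sort.
apply: (@eq_from_nth _ 0); rewrite size_mkseq ?sd // => j jK.
rewrite nth_mkseq // /digit xE ?ltn_add2l //.
by rewrite ltnNge leq_addr /= addKn.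
Qed.

(** Points move one at a time from the arbitrary list [ys] to the grid list [zs]: [vertex_factor h]
    is a polynomial of degree K, so the K + 1 nodes 0, ..., K interpolate it. *)
Lemma Lin_vertices (xs : nat -> nat) (ys : seq F) (zs : seq nat) :
  (forall j, j < r -> xs j <= r) -> size ys + size zs = K ->
  all (fun y => y <= K) zs ->
  Lin (Mix (fun j => (xs j)%:R%R) (ys ++ [seq y%:R%R | y <- zs])).
Proof.
move=> xr; elim: ys zs => [|y ys IH] zs /= sz az; first exact: Lin_grid.
have [L LE] := interpolation pp K.+1 y.
apply: (@Lin_ext (fun h => \sum_(x < K.+1) L x *
   Mix (fun j => (xs j)%:R) (ys ++ [seq z%:R | z <- val x :: zs]) h)%R); last first.
  apply: (Lin_sum L (A := fun x => Mix (fun j => (xs j)%:R)%R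
     (ys ++ [seq z%:R%R | z <- x :: zs]))) => x xK.
  by apply: IH; rewrite /= ?addnS // -ltnS xK.
move=> h; rewrite /Mix big_cons.
pose g : {poly F} := (\prod_(i < K) ('X - (h i)%:R%:P))%R.
have gE x : (vertex_factor h x = g.[x])%R.
  by rewrite /g horner_prod; apply: eq_bigr => i _; rewrite !hornerE.
rewrite gE LE; last by rewrite size_prod_XsubC /index_enum -enumT size_enum_ord.
rewrite mulr_suml mulr_sumr; apply: eq_bigr => x _.
rewrite !big_cat big_cons /= gE; ring.
Qed.

(** The color coordinates are moved to the grid in the same way, coordinate j having degree r - j.
    In the induction, [m] counts the coordinates that may still be arbitrary. *)
Lemma Lin_Mix (xs : nat -> F) (ys : seq F) : size ys = K -> Lin (Mix xs ys).
Proof.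
move=> sy.
suff H m : m <= r -> forall xs : nat -> F,
    (forall j, m <= j < r -> exists2 x, x <= r & xs j = x%:R%R) ->
    Lin (Mix xs ys).
  by apply: (H r (leqnn r)) => j; lia.
elim: m {xs} => [_|m IH mr] xs xsE.
  have [zs zsE] : exists zs, forall j, j < r -> zs j <= r /\ xs j = (zs j)%:R%R.
    exists (fun j => odflt 0 (omap val [pick x : 'I_r.+1 | xs j == (val x)%:R%R])).
    move=> j jr; case: pickP => [x /eqP xE|no] /=; first by rewrite -ltnS ltn_ord.
    have [x xr xE] := xsE j jr.
    by have := no (@Ordinal r.+1 x xr); rewrite /= xE eqxx.
  apply: (@Lin_ext (Mix (fun j => (zs j)%:R%R) (ys ++ [seq y%:R%R | y <- [::]]))).
    move=> h; rewrite /Mix cats0; congr (_ * _)%R; apply: eq_bigr => j _.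
    by rewrite (zsE j (ltn_ord j)).2.
  by apply: Lin_vertices => [j /zsE[]||] //; rewrite addn0.
have [L LE] := interpolation pp r.+1 (xs m).
pose up x j := if j == m then (x%:R%R : F) else xs j.
apply: (@Lin_ext (fun h => \sum_(x < r.+1) L x * Mix (up x) ys h)%R); last first.
  apply: (Lin_sum L (A := fun x => Mix (up x) ys)) => x xr.
  apply: IH => [|j /andP[mj jr]]; first exact: ltnW.
  rewrite /up; case: eqP => [_|jm]; first by exists x.
  by apply: xsE; lia.
move=> h; rewrite /Mix (bigD1 (Ordinal mr)) //=.
pose g : {poly F} := (\prod_(i < r - m) ('X - (cl (h i))%:R%:P))%R.
have gE x : (color_factor h m x = g.[x])%R.
  by rewrite /g horner_prod; apply: eq_bigr => i _; rewrite !hornerE.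
rewrite gE LE; last first.
  by rewrite size_prod_XsubC /index_enum -enumT size_enum_ord ltnS leq_subr.
rewrite !mulr_suml; apply: eq_bigr => x _.
rewrite (bigD1 (Ordinal mr)) //= {1}/up eqxx gE !mulrA; congr (_ * _ * _)%R.
by apply: eq_bigr => j; rewrite -val_eqE /= /up => /negPf ->.
Qed.
End Tests.

(** * Continuations of a partial walk and the tests they define *)

Section Futures.
Variables (n r K : nat) (cl : nat -> nat) (E : nat -> nat -> Prop).
Hypothesis E_lt : forall u v, E u v -> v < n.
Hypothesis cl_lt : forall v, v < n -> cl v < n.
Hypothesis cl_n : cl n = n.

(* Histories list the vertices of a walk from the last one backwards, padded
   with the dummy vertex n. *)
Definition fits (h : nat -> nat) (v : nat) : Prop :=
  (forall k, k < r -> cl v <> cl (h k)) /\ (forall k, k < K -> v <> h k).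

Fixpoint future (rs Q : seq nat) : Prop :=
  if Q is v :: Q' then
    [/\ E (nth n rs 0) v, fits (nth n rs) v & future (v :: rs) Q']
  else True.

(** [acc] is the part of the continuation already walked, stacked in front of the history; in the
    induction it shifts all distances by its size. *)
Lemma future_fits acc rs Q : future (acc ++ rs) Q ->
  forall i j, j < size Q ->
    [/\ nth n Q j < n,
        i + j + size acc < r -> cl (nth n Q j) <> cl (nth n rs i) &
        i + j + size acc < K -> nth n Q j <> nth n rs i].
Proof.
elim: Q acc => [|v Q IH] acc //= [/E_lt vn [f1 f2] fQ] i [_|j]; last first.
  rewrite ltnS => jQ; have := IH (v :: acc) fQ i j jQ; rewrite /=.
  by rewrite !addnS !addSn.
have e : nth n (acc ++ rs) (size acc + i) = nth n rs i.
  by rewrite nth_cat ltnNge leq_addr /= addKn.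
by rewrite -e addn0 addnC; split=> //; [apply: f1|apply: f2].
Qed.

(** Conditions among the vertices of [acc] and [Q] do not involve the old history, so only those
    against [rs'] have to be checked anew. Equal heads serve the first arc. *)
Lemma future_swap acc rs rs' Q :
  future (acc ++ rs) Q -> nth n rs 0 = nth n rs' 0 ->
  (forall i j, j < size Q -> i + j + size acc < r ->
     cl (nth n Q j) <> cl (nth n rs' i)) ->
  (forall i j, j < size Q -> i + j + size acc < K ->
     nth n Q j <> nth n rs' i) ->
  future (acc ++ rs') Q.
Proof.
move=> + rr; elim: Q acc => [|v Q IH] acc //= [Ev [f1 f2] fQ] c1 c2.
have e k : k < size acc -> nth n (acc ++ rs') k = nth n (acc ++ rs) k.
  by move=> ka; rewrite !nth_cat ka.
have e' k : size acc <= k -> nth n (acc ++ rs') k = nth n rs' (k - size acc).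
  by move=> ka; rewrite !nth_cat ltnNge ka.
split.
- by case: acc {IH f1 f2 fQ c1 c2 e e'} Ev => //=; rewrite rr.
- split=> k kr; have [ka|ka] := ltnP k (size acc).
  + by rewrite e //; apply: f1.
  + by rewrite e' //; apply: (c1 _ 0) => //; lia.
  + by rewrite e //; apply: f2.
  + by rewrite e' //; apply: (c2 _ 0) => //; lia.
- apply: (IH (v :: acc)) => //= i j jQ ij; [apply: (c1 i j.+1)|apply: (c2 i j.+1)] => //; lia.
Qed.

Variable p : nat.
Hypotheses (pp : prime p) (np : n.+1 < p).

(** A short continuation is padded with n + 1, which differs from every vertex, every renamed color
    and the dummy n of the histories. *)
Definition test (Q : seq nat) : (nat -> nat) -> 'F_p :=
  Mix r K cl (fun j => (nth n.+1 [seq cl v | v <- Q] j)%:R%R)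
    (mkseq (fun j => (nth n.+1 Q j)%:R%R) K).

Lemma test_neq0 Q h : (forall i, h i <= n) -> all (fun v => v < n) Q ->
  reflect (forall i j, j < size Q ->
             (i + j < r -> cl (nth n Q j) <> cl (h i)) /\
             (i < K -> j < K -> nth n Q j <> h i))
          (test Q h != 0%R).
Proof.
move=> hn Qn.
have cn v : v <= n -> cl v <= n.
  by rewrite leq_eqVlt => /orP[/eqP->|/cl_lt/ltnW//]; rewrite cl_n.
have Q1 j : j < size Q -> nth n Q j < n by move=> jQ; apply: (all_nthP n Qn).
have key a b : a <= n.+1 -> b <= n.+1 ->
    ((a%:R - b%:R)%R != 0%R :> 'F_p) = (a != b).
  move=> an bn; rewrite subr_eq0; congr negb.
  by apply/eqP/eqP => [/(Fp_natr_inj pp)|-> //]; apply; lia.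
rewrite /test /Mix mulf_eq0 negb_or; apply: (iffP andP) => [[c1 c2] i j jQ|H].
  have Qj := Q1 j jQ; split.
    move=> ij; have jr : j < r by lia.
    have ir : i < r - j by lia.
    move/prodf_neq0: c1 => /(_ (Ordinal jr) isT)/prodf_neq0/(_ (Ordinal ir) isT).
    rewrite /= (nth_map n) // key; first by move/eqP.
      by have := cl_lt Qj; lia.
    by have := cn _ (hn i); lia.
  move=> iK jK; move: c2; rewrite prodf_seq_neq0 => /allP/(_ (nth n.+1 Q j)%:R%R).
  have jm : (nth n.+1 Q j)%:R%R \in mkseq (fun j => (nth n.+1 Q j)%:R%R : 'F_p) K.
    by apply/mapP; exists j; rewrite ?mem_iota.
  move/(_ jm)/prodf_neq0 => /(_ (Ordinal iK) isT); rewrite /= key.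
  + by move/eqP; rewrite (set_nth_default n).
  + by rewrite (set_nth_default n) //; lia.
  + by have := hn i; lia.
split.
  apply/prodf_neq0 => j _; apply/prodf_neq0 => i _.
  have ci := cn _ (hn i).
  have [jQ|jQ] := ltnP j (size Q); last first.
    by rewrite nth_default ?size_map // key ?ltnS //; apply/eqP; lia.
  rewrite (nth_map n) // key; first by apply/eqP; apply: (H i j jQ).1; have := ltn_ord i; lia.
    by have := cl_lt (Q1 j jQ); lia.
  lia.
rewrite prodf_seq_neq0; apply/allP => y /mapP[j]; rewrite mem_iota add0n /= => jK -> {y}.
apply/prodf_neq0 => i _; have ci := hn i.
have [jQ|jQ] := ltnP j (size Q); last first.
  by rewrite nth_default // key ?ltnS //; apply/eqP; lia.
have Qj := Q1 j jQ; rewrite (set_nth_default n) // key; try lia.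
by apply/eqP; apply: (H i j jQ).2.
Qed.
End Futures.

(** * Modular arithmetic on the machine *)

Infix ";;" := Seq (at level 61, right associativity).

Notation "x ::= e" := (SetReg x e) (at level 60).

Lemma agree_reg P st st' x v :
  agree P st st' -> reg st x = v -> x \notin wreg P -> reg st' x = v.
Proof. by move=> [ag _] <- xP; apply: ag. Qed.

Lemma agree_arr P st st' x v :
  agree P st st' -> arr st x = v -> x \notin warr P -> arr st' x = v.
Proof. by move=> [_ ag] <- xP; apply: ag. Qed.

(* Transports the facts on registers and arrays that ag leaves unchanged. *)
Ltac fr ag :=
  match type of ag with
  | agree _ ?s ?s1 =>
    repeat match goal with
    | H : reg ?s0 ?x = ?v |- _ =>
      lazymatch s0 with s1 => fail | _ => idtac end;
      let H' := fresh "fr" in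
      assert (H' : reg s1 x = v) by exact (@agree_reg _ s s1 x v ag H isT);
      clear H; rename H' into H
    | H : arr ?s0 ?x = ?v |- _ =>
      lazymatch s0 with s1 => fail | _ => idtac end;
      let H' := fresh "fr" in
      assert (H' : arr s1 x = v) by exact (@agree_arr _ s s1 x v ag H isT);
      clear H; rename H' into H
    end
  end.

Ltac rw :=
  repeat match goal with
  | H : reg ?s ?x = _ |- context [reg ?s ?x] => rewrite !H
  | H : arr ?s ?x = _ |- context [arr ?s ?x] => rewrite !H
  end.

Ltac seqset := apply/wp_seq/wp_set => /=; rw.

(* Registers, besides the input: 6 dist(s,t), 7 K, 8 D, 9 p, 10 success flag,
   11 r + 1, 12 and 13 the first slots of the current and the next level.
   Arrays: 3 breadth first levels (plus 1), 4 composite numbers, 5 colors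
   renamed to vertices, 6 to 8 the tables H, X and F, 9 to 11 the candidate
   history, its colors and its vector. *)
Definition MulMod : program :=
  22 ::= Const 0 ;;
  For 23 (Reg 21) (
    22 ::= Add (Reg 22) (Reg 20) ;;
    If (Sub (Add (Reg 22) (Const 1)) (Reg 9))
      (22 ::= Sub (Reg 22) (Reg 9)) Skip) ;;
  20 ::= Reg 22.

Lemma wp_MulMod st p a z : reg st 9 = p -> reg st 20 = a -> reg st 21 = z ->
  a < p ->
  wp MulMod st (fun st' T =>
    [/\ reg st' 20 = (a * z) %% p & T <= 40 * z.+1]).
Proof.
move=> rp ra rz ap; seqset; apply: wp_seq.
apply: (@wp_for _ _ _ _ z 20
  (fun i st' => reg st' 22 = (a * i) %% p)) => //=.
- by rewrite muln0 mod0n.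
- move=> j st1 jz ag _ Ij; fr ag.
  have p0 : 0 < p by apply: leq_ltn_trans ap.
  have cp := ltn_pmod (a * j) p0.
  have e : (a * j.+1) %% p = ((a * j) %% p + a) %% p.
    by rewrite modnDml mulnS addnC.
  seqset; apply/wp_if => /=; rw => h.
    apply: wp_set; split=> //=; rw; rewrite e.
have pl : p <= (a * j) %% p + a by lia.
    have lt : (a * j) %% p + a - p < p by lia.
    by rewrite -[in RHS](subnK pl) modnDr (modn_small lt).
  by apply: wp_skip; split=> //=; rewrite e [RHS]modn_small //; lia.
move=> st2 T ag _ I2 TB; apply: wp_set; split=> /=; first by rw.
by lia.
Qed.

Definition DivMod : program :=
  28 ::= Reg 27 ;;
  29 ::= Const 0 ;;
  For 30 (Reg 27) (
    If (Sub (Add (Reg 28) (Const 1)) (Reg 11))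
      (28 ::= Sub (Reg 28) (Reg 11) ;; 29 ::= Add (Reg 29) (Const 1))
      Skip) ;;
  27 ::= Reg 29.

Lemma wp_DivMod st q R : reg st 27 = q -> reg st 11 = R -> 0 < R ->
  wp DivMod st (fun st' T =>
    [/\ reg st' 27 = q %/ R, reg st' 28 = q %% R & T <= 40 * q.+1]).
Proof.
move=> rq rR R0; do 2!seqset; apply: wp_seq.
(* Either the remainder is already small or every round so far has subtracted R; q subtractions
   would leave no remainder. *)
apply: (@wp_for _ _ _ _ q 20 (fun i st' =>
  q = reg st' 29 * R + reg st' 28 /\ (reg st' 28 < R \/ reg st' 29 = i))) => //=.
- by split=> //; right.
- move=> j st1 jq ag _ [Ij1 Ij2]; fr ag; apply: wp_if => /=; rw => h.
    by seqset; apply/wp_set; split=> //=; rw; split; nia.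
  by apply: wp_skip; split=> //=; rw; split=> //; left; lia.
move=> st2 T ag _ [I1 I2] TB; apply: wp_set => /=.
have lt : reg st2 28 < R by case: I2 => // e; nia.
rewrite [in q %/ R]I1 [in q %% R]I1 divnMDl // modnMDl divn_small // modn_small //.
by split; rewrite ?addn0 //; lia.
Qed.

(** The added p keeps the truncated subtraction exact; [MulMod] accepts an unreduced second
    factor. *)
Definition Prod (a : nat) : program :=
  For 26 (Reg 25) (
    21 ::= Sub (Add (Reg 24) (Reg 9)) (Get a (Reg 26)) ;; MulMod).

Lemma wp_Prod a st p c x m f : prime p ->
  reg st 9 = p -> reg st 20 = c -> reg st 24 = x -> reg st 25 = m ->
  arr st a = f -> c < p -> (forall i, i < m -> f i <= p) ->
  wp (Prod a) st (fun st' T =>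
    [/\ reg st' 20 < p,
        ((reg st' 20)%:R =
           c%:R * \prod_(i < m) (x%:R - (f i)%:R) :> 'F_p)%R &
        T <= 80 * (m.+1 * (x + p).+1)]).
Proof.
move=> pp rp rc rx rm af cp fp; rewrite /Prod.
apply: (@wp_for _ _ _ _ m (50 * (x + p).+1) (fun i st' =>
  reg st' 20 < p /\ ((reg st' 20)%:R =
           c%:R * \prod_(j < i) (x%:R - (f j)%:R) :> 'F_p)%R)) => //=.
- by rewrite rc big_ord0 mulr1.
- move=> j st1 jm ag rj [Ij1 Ij2]; fr ag.
  seqset; apply: wp_conseq.
    exact: (@wp_MulMod _ p (reg st1 20) (x + p - f j)).
  move=> st2 T ag2 [r20 TB]; split; first by have := fp j jm; lia.
  rewrite r20 ltn_pmod ?(prime_gt0 pp) //; split=> //.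
  rewrite Fp_natr_modn // natrM Ij2 big_ord_recr /= -mulrA; congr (_ * (_ * _))%R.
  by rewrite -addnBA ?fp // natrD Fp_natrB // fp.
by move=> st2 T ag _ [I1 I2] TB; split=> //; nia.
Qed.

Definition Phi : program :=
  20 ::= Const 1 ;;
  27 ::= Reg 31 ;;
  For 32 (Reg 4) (
    DivMod ;;
    24 ::= Reg 28 ;;
    25 ::= Sub (Reg 4) (Reg 32) ;;
    Prod 10) ;;
  33 ::= Const 0 ;;
  For 32 (Add (Reg 7) (Reg 7)) (
    DivMod ;;
    If (Reg 28)
      (24 ::= Reg 33 ;; 25 ::= Reg 7 ;; Prod 9)
      (33 ::= Add (Reg 33) (Const 1))).

Lemma wp_Phi st n p r K D cl x h g : prime p -> n < p ->
  reg st 9 = p -> reg st 4 = r -> reg st 7 = K -> reg st 11 = r.+1 ->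
  reg st 31 = x -> arr st 9 = h -> arr st 10 = g ->
  x < D -> r < D -> K < D ->
  (forall i, i < D -> h i <= n) -> (forall i, i < D -> g i <= n) ->
  (forall i, i < D -> g i = cl (h i)) ->
  wp Phi st (fun st' T =>
    [/\ reg st' 20 < p, ((reg st' 20)%:R = phi p r K cl h x)%R &
        T <= 1000 * (D * D * (p + D + D))]).
Proof.
move=> pp np rp rr rK rR rx ah ag0 xD rD KD hn gn gh.
have p1 := prime_gt1 pp.
do 2!seqset; apply: wp_seq.
(* The order of one round: at most D factors, each multiplied in time O(p + D). *)
have [Y YE] : exists Y, Y = D * (p + D + D) by eexists.
have DY : D <= Y by rewrite YE leq_pmulr //; lia.
have Y0 : 0 < Y by lia.
apply: (@wp_for _ _ _ _ r (200 * Y) (fun j st' =>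
  [/\ reg st' 20 < p, reg st' 27 = x %/ r.+1 ^ j &
     ((reg st' 20)%:R =
         \prod_(i < j) color_factor r cl h i (digit r x i)%:R :> 'F_p)%R])) => //=.
- by rewrite big_ord0 expn0 divn1.
- move=> j st1 jr ag rj [I1 I2 I3]; fr ag.
  apply/wp_seq/wp_conseq; first exact: (@wp_DivMod _ (x %/ r.+1 ^ j) r.+1).
  move=> st2 T2 ag2 [q2 m2 T2B]; fr ag2.
  have q2D : x %/ r.+1 ^ j < D by apply: leq_ltn_trans (leq_div _ _) xD.
  have mr : (x %/ r.+1 ^ j) %% r.+1 <= r by rewrite -ltnS ltn_pmod.
  have e20 : reg st2 20 = reg st1 20 by rewrite ag2.1.
  do 2!seqset; apply: wp_conseq.
    apply: (@wp_Prod 10 _ p (reg st1 20) ((x %/ r.+1 ^ j) %% r.+1) (r - j) g) => //=.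
    by move=> i ij; apply: leq_trans (gn i _) (ltnW np); lia.
  have bd : (r - j).+1 * ((x %/ r.+1 ^ j) %% r.+1 + p).+1 <= Y.
    by rewrite YE; apply: leq_mul; lia.
  move=> st3 T3 ag3 [lt3 v3 T3B]; split; first by lia.
  have q3 : reg st3 27 = x %/ r.+1 ^ j %/ r.+1 by rewrite ag3.1.
  split=> //=; first by rewrite q3 expnSr divnMA.
  rewrite v3 I3 big_ord_recr /=; congr (_ * _)%R.
  apply: eq_bigr => i _; rewrite gh // (leq_trans (ltn_ord i)) //; lia.
move=> st1 T1 ag1 _ [I1 I2 I3] T1B; fr ag1.
seqset.
pose dg j := digit r x (r + j).
apply: (@wp_for _ _ _ _ (K + K) (200 * Y) (fun j st' =>
  [/\ reg st' 20 < p, reg st' 27 = x %/ r.+1 ^ (r + j),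
      reg st' 33 = (yrun p K h (mkseq dg j)).1 /\ reg st' 33 <= j &
     ((reg st' 20)%:R = (reg st1 20)%:R * (yrun p K h (mkseq dg j)).2)%R])) => //=.
- by rw.
- by rewrite addn0 mulr1.
- move=> j st2 jr ag rj [J1 J2 [J3 J3'] J4]; rewrite J3 in J3'; fr ag.
  apply/wp_seq/wp_conseq; first exact: (@wp_DivMod _ (x %/ r.+1 ^ (r + j)) r.+1).
  move=> st3 T3 ag3 [q3 m3 T3B].
  have e20 : reg st3 20 = reg st2 20 by rewrite ag3.1.
  fr ag3.
  have q2D : x %/ r.+1 ^ (r + j) < D by apply: leq_ltn_trans (leq_div _ _) xD.
  have dE : dg j = (x %/ r.+1 ^ (r + j)) %% r.+1 by [].
  have rS : forall a, yrun p K h (mkseq dg j) = a ->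
      yrun p K h (mkseq dg j.+1) = ystep (fun y => vertex_factor K h y%:R%R) a (dg j).
    by move=> a <-; rewrite mkseqS /yrun foldl_rcons.
  case ya : (yrun p K h (mkseq dg j)) => [y a] in J3 J3' J4 rS.
  rewrite /= in J3 J3' J4.
  have {rS} := rS _ erefl; rewrite /ystep /= dE => rS.
  apply: wp_if => /=; rw => h0.
    do 2!seqset; apply: wp_conseq.
      apply: (@wp_Prod 9 _ p (reg st2 20) y K h) => //=.
      by move=> i ij; apply: leq_trans (hn i _) (ltnW np); lia.
    have bd : K.+1 * (y + p).+1 <= Y.
      by rewrite YE; apply: leq_mul; lia.
    move=> st4 T4 ag4 [lt4 v4 T4B]; split.
      by move: (x %/ _) q2D T3B => q q2D T3B; clear -bd T3B T4B q2D DY Y0; lia.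
    have q4 : reg st4 27 = x %/ r.+1 ^ (r + j) %/ r.+1 by rewrite ag4.1.
    have e33' : reg st4 33 = y by rewrite ag4.1.
    split=> //=; first by rewrite q4 addnS expnSr divnMA.
      by rewrite rS (negPf h0) e33' /=; split=> //; apply: leqW.
    by rewrite rS (negPf h0) v4 J4 /= mulrA.
  apply: wp_set; split=> /=; first by lia.
  split=> //=; first by rw.
  - by rw; rewrite addnS expnSr divnMA.
  - by rw; rewrite rS h0 /=; split; lia.
  - by rw; rewrite rS h0 /= J4.
move=> st2 T2 ag2 _ [J1 J2 J3 J4] T2B; split=> //; last first.
  have m1 : r * (200 * Y + 8) <= D * (208 * Y) by apply: leq_mul; lia.
  have m2 : (K + K) * (200 * Y + 10) <= (D + D) * (210 * Y).
    by apply: leq_mul; lia.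
  have m3 : Y <= D * Y by rewrite leq_pmull //; lia.
  rewrite -mulnA -YE; move: T1B T2B => /=; lia.
by rewrite J4 I3 /phi.
Qed.

(** * Representative tables *)

Section Tables.
Variables (p n r K D : nat) (cl : nat -> nat).
Hypotheses (pp : prime p) (rD : r < D) (KD : K < D).
Implicit Types (F H X : nat -> nat) (w : nat -> 'F_p).

Definition pairing w (g : nat -> 'F_p) : 'F_p := (\sum_(x < D) w x * g x)%R.

(* Slot f occupies the cells f * D, ..., f * D + D - 1 of H and X. *)
Definition hist H (f k : nat) : nat := H (f * D + k).
Definition vect X (f x : nat) : 'F_p := ((X (f * D + x))%:R)%R.

Lemma phi_ext h h' x : (forall i, i < D -> h i = h' i) ->
  phi p r K cl h x = phi p r K cl h' x.
Proof.
move=> hh; rewrite /phi; congr (_ * _)%R.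
  apply: eq_bigr => j _; apply: eq_bigr => i _; rewrite hh //.
  by have := ltn_ord i; lia.
congr (foldl _ _ _).2; apply: functional_extensionality => a.
apply: functional_extensionality => d; rewrite /ystep; case: ifP => // _.
congr (_, _ * _)%R; apply: eq_bigr => i _; rewrite hh //.
by have := ltn_ord i; lia.
Qed.

Lemma Mix_ext xs ys h h' : (forall i, i < D -> h i = h' i) ->
  Mix (p := p) r K cl xs ys h = Mix r K cl xs ys h'.
Proof.
move=> hh; rewrite /Mix; congr (_ * _)%R.
  apply: eq_bigr => j _; apply: eq_bigr => i _; rewrite hh //.
  by have := ltn_ord i; lia.
apply: eq_bigr => y _; apply: eq_bigr => i _; rewrite hh //.
by have := ltn_ord i; lia.
Qed.

Lemma pairing_ext w g g' : (forall x, x < D -> g x = g' x) ->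
  pairing w g = pairing w g'.
Proof. by move=> gg; apply: eq_bigr => x _; rewrite gg. Qed.

Lemma pairing_lin w a b g g' :
  (pairing w (fun x => a * g x + b * g' x) = a * pairing w g + b * pairing w g')%R.
Proof.
rewrite /pairing !big_distrr -big_split /=; apply: eq_bigr => x _; ring.
Qed.

Definition vanish F H g w : Prop :=
  forall q, q < D -> F (g + q) != 0 ->
    pairing w (phi p r K cl (hist H (g + q))) = 0%R.

(** The slot number within a group is the pivot column. So D slots hold any independent family, and
    the row to eliminate with is found without a search. *)
Definition echelon F X g : Prop :=
  forall q, q < D -> F (g + q) != 0 ->
    [/\ forall x, x < D -> X ((g + q) * D + x) < p,
        forall x, x < q -> X ((g + q) * D + x) = 0 &
        X ((g + q) * D + q) != 0].

(* Membership in the span of the stored phi vectors is expressed dually, by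
   the functionals w that vanish on all of them. *)
Definition table F H X g : Prop :=
  echelon F X g /\
  forall w, vanish F H g w -> forall q, q < D -> F (g + q) != 0 ->
    pairing w (vect X (g + q)) = 0%R.

Definition covered F H g (h : nat -> nat) : Prop :=
  forall w, vanish F H g w -> pairing w (phi p r K cl h) = 0%R.

(** Modulo the stored span, [xv] behaves like a nonzero multiple of the vector of [h]. Only the
    vanishing of pairings is compared, so the scaling by pivots needs no bookkeeping. *)
Definition reduced F H g (h xv : nat -> nat) q : Prop :=
  [/\ forall x, x < D -> xv x < p, forall x, x < q -> xv x = 0 &
      forall w, vanish F H g w ->
        (pairing w (fun x => (xv x)%:R) = 0 <->
         pairing w (phi p r K cl h) = 0)%R].

Definition stored F H X F' H' X' (f : nat) (h xv : nat -> nat) : Prop :=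
  [/\ F f = 0, forall f', F' f' = if f' == f then 1 else F f',
      forall k, k < D -> H' (f * D + k) = h k /\ X' (f * D + k) = xv k &
      forall f' k, f' != f -> k < D ->
        H' (f' * D + k) = H (f' * D + k) /\ X' (f' * D + k) = X (f' * D + k)].

Lemma natr_eq0_lt a : a < p -> (a%:R = 0 :> 'F_p)%R -> a = 0.
Proof. by move=> ap; apply: (@Fp_natr_inj p pp a 0); rewrite ?prime_gt0. Qed.

Lemma reduced_init F H g h xv : (forall x, x < D -> xv x < p) ->
  (forall x, x < D -> (xv x)%:R%R = phi p r K cl h x) -> reduced F H g h xv 0.
Proof. by move=> xp xE; split=> // w _; rewrite (pairing_ext _ xE). Qed.

Lemma reduced_skip F H g h xv q : xv q = 0 -> reduced F H g h xv q ->
  reduced F H g h xv q.+1.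
Proof.
move=> x0 [x1 x2 x3]; split=> // x; rewrite ltnS leq_eqVlt.
by case/orP=> [/eqP-> //|/x2].
Qed.

Lemma reduced_covered F H g h xv : reduced F H g h xv D -> covered F H g h.
Proof.
move=> [_ x0 xw] w /xw <-; rewrite /pairing big1 // => x _.
by rewrite x0 // mulr0.
Qed.

(** The subtracted row pairs to zero with every vanishing [w], and the factor on the old row is a
    pivot, nonzero modulo p. *)
Lemma reduced_step F H X g h xv xv' q : q < D -> table F H X g ->
  F (g + q) != 0 -> reduced F H g h xv q ->
  (forall x, x < D -> xv' x < p) ->
  (forall x, x < D -> ((xv' x)%:R =
     (X ((g + q) * D + q))%:R * (xv x)%:R -
     (xv q)%:R * (X ((g + q) * D + x))%:R :> 'F_p)%R) ->
  reduced F H g h xv' q.+1.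
Proof.
move=> qD [ec sp] Fq [x1 x2 x3] xp xE; have [e1 e2 e3] := ec q qD Fq.
split=> // [x xq|w vw].
  apply: natr_eq0_lt; first by apply: xp; lia.
  rewrite xE; last by lia.
  move: xq; rewrite ltnS leq_eqVlt => /orP[/eqP->|xq]; first by rewrite mulrC subrr.
  by rewrite (x2 _ xq) (e2 _ xq) !mulr0 subrr.
rewrite -(x3 w vw).
have -> : (pairing w (fun x => (xv' x)%:R) =
  (X ((g + q) * D + q))%:R * pairing w (fun x => (xv x)%:R) +
  (- (xv q)%:R) * pairing w (vect X (g + q)))%R.
  rewrite -pairing_lin; apply: pairing_ext => x xD.
  by rewrite xE // mulNr.
rewrite (sp w vw q qD Fq) mulr0 addr0; split=> [/eqP|->]; last by rewrite mulr0.
rewrite mulf_eq0 => /orP[/eqP e0|/eqP //].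
by case/eqP: e3; apply: natr_eq0_lt e0; apply: e1.
Qed.

Lemma stored_vanish F H X F' H' X' f h xv g w :
  stored F H X F' H' X' f h xv -> vanish F' H' g w -> vanish F H g w.
Proof.
move=> [F0 F'E new old] v q qD Fq.
have qf : g + q != f by apply: contraNneq Fq => ->; rewrite F0.
have := v q qD; rewrite F'E (negPf qf) => /(_ Fq) <-.
apply: pairing_ext => x _; apply: phi_ext => k kD.
by rewrite /hist (old _ _ qf kD).1.
Qed.

Lemma stored_table_other F H X F' H' X' f h xv g :
  stored F H X F' H' X' f h xv -> (forall q, q < D -> g + q != f) ->
  table F H X g -> table F' H' X' g.
Proof.
move=> st nf [ec sp]; have [F0 F'E new old] := st; split.
  move=> q qD; rewrite F'E (negPf (nf q qD)) => /(ec q qD)[e1 e2 e3]; split.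
  - by move=> x xD; rewrite (old _ _ (nf q qD) xD).2 e1.
  - by move=> x xq; rewrite (old _ _ (nf q qD) _).2 ?e2 //; lia.
  - by rewrite (old _ _ (nf q qD) qD).2.
move=> w /(stored_vanish st) v q qD; rewrite F'E (negPf (nf q qD)) => Fq.
rewrite -[RHS](sp w v q qD Fq); apply: pairing_ext => x xD.
by rewrite /vect (old _ _ (nf q qD) xD).2.
Qed.

Lemma stored_covered F H X F' H' X' f h xv g h' :
  stored F H X F' H' X' f h xv -> covered F H g h' -> covered F' H' g h'.
Proof. by move=> st c w /(stored_vanish st) /c. Qed.

(** Storing [h] leaves fewer vanishing functionals. Those that remain kill the vector of [h], hence
    by [reduced] also the remainder [xv], whose first nonzero entry is at its slot q. *)
Lemma stored_table F H X F' H' X' g q h xv :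
  q < D -> stored F H X F' H' X' (g + q) h xv -> table F H X g ->
  reduced F H g h xv q -> xv q != 0 ->
  table F' H' X' g /\ covered F' H' g h.
Proof.
move=> qD st [ec sp] [x1 x2 x3] xq; have [F0 F'E new old] := st.
have nf q' : q' != q -> g + q' != g + q by rewrite eqn_add2l.
have cov : covered F' H' g h.
  move=> w v; have := v q qD; rewrite F'E eqxx => /(_ isT) <-.
  apply: pairing_ext => x _; apply: phi_ext => k kD.
  by rewrite /hist (new k kD).1.
split=> //; split.
  move=> q' q'D; rewrite F'E; have [->{q' q'D} _|/nf qq] := eqVneq q' q.
    split=> [x xD|x xlt|]; rewrite (new _ _).2 //; try lia.
    - exact: x1.
    - exact: x2.
  rewrite (negPf qq) => /(ec q' q'D)[e1 e2 e3]; split.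
  - by move=> x xD; rewrite (old _ _ qq xD).2 e1.
  - by move=> x xq'; rewrite (old _ _ qq _).2 ?e2 //; lia.
  - by rewrite (old _ _ qq q'D).2.
move=> w v' q' q'D; have v := stored_vanish st v'.
rewrite F'E; have [->{q' q'D} _|/nf qq] := eqVneq q' q.
  have [_ xw] := x3 w v; rewrite -[RHS]xw; last exact: cov.
  by apply: pairing_ext => x xD; rewrite /vect (new x xD).2.
rewrite (negPf qq) => Fq; rewrite -[RHS](sp w v q' q'D Fq).
by apply: pairing_ext => x xD; rewrite /vect (old _ _ qq xD).2.
Qed.
End Tables.

(** * Walks stored level by level, and why the stored ones suffice *)

Inductive walk (n r K : nat) (cl : nat -> nat) (E : nat -> nat -> Prop)
    (s : nat) : nat -> seq nat -> Prop :=
  | Walk0 : walk n r K cl E s 0 [:: s]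
  | WalkS i v rs : walk n r K cl E s i rs -> E (nth n rs 0) v ->
      fits r K cl (nth n rs) v -> walk n r K cl E s i.+1 (v :: rs).

Definition slot (n D i v : nat) : nat := (i * n + v) * D.

Lemma slot_inj n D i v q i' v' q' : v < n -> v' < n -> q < D -> q' < D ->
  slot n D i v + q = slot n D i' v' + q' -> [/\ i = i', v = v' & q = q'].
Proof.
rewrite /slot => vn vn' qD qD' e.
have D0 : 0 < D by lia.
have n0 : 0 < n by lia.
have e1 : (slot n D i v + q) %/ D = (slot n D i' v' + q') %/ D by rewrite /slot e.
rewrite /slot !divnMDl // (divn_small qD) (divn_small qD') !addn0 in e1.
have e2 : (i * n + v) %/ n = (i' * n + v') %/ n by rewrite e1.
rewrite !divnMDl // (divn_small vn) (divn_small vn') !addn0 in e2.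
by subst i'; split=> //; lia.
Qed.

Section Search.
Variables (p n r K D : nat) (cl : nat -> nat) (E : nat -> nat -> Prop).
Variables (s t l : nat).
Hypotheses (pp : prime p) (np : n.+1 < p) (rD : r < D) (KD : K < D).
Hypothesis RD : r.+1 ^ (r + (K + K)) <= D.
Hypothesis r0K : 0 < K -> 0 < r.
Hypotheses (sn : s < n) (tn : t < n) (st : s != t).
Hypothesis E_lt : forall u v, E u v -> u < n /\ v < n.
Hypothesis cl_lt : forall v, v < n -> cl v < n.
Hypothesis cl_n : cl n = n.
Local Notation slot := (slot n D).
Local Notation walk := (walk n r K cl E s).
Local Notation future := (future n r K cl E).
Local Notation fits := (fits r K cl).
Local Notation table := (table p r K D cl).
Local Notation covered := (covered p r K D cl).
Implicit Types (F H X : nat -> nat) (rs Q : seq nat).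

Lemma walk_size i rs : walk i rs -> size rs = i.+1.
Proof. by elim=> //= {}i v {}rs _ ->. Qed.

Lemma walk_lt i rs : walk i rs -> all (fun v => v < n) rs.
Proof. by elim=> [|{}i v {}rs _ IH /E_lt[_ vn] _] /=; rewrite ?sn ?vn. Qed.

Lemma walk_nth_le i rs k : walk i rs -> nth n rs k <= n.
Proof.
move=> w; have [kr|kr] := ltnP k (size rs); last by rewrite nth_default.
exact/ltnW/(all_nthP n (walk_lt w)).
Qed.

Lemma walk_head i rs : walk i rs -> nth n rs 0 < n.
Proof.
by move=> w; apply: (all_nthP n (walk_lt w)); rewrite (walk_size w).
Qed.

Lemma walkS_inv i rs : walk i.+1 rs -> exists v rs0,
  [/\ rs = v :: rs0, walk i rs0, E (nth n rs0 0) v & fits (nth n rs0) v].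
Proof.
by move=> w; inversion w as [|i' v rs0 w0 Ev fv]; exists v, rs0.
Qed.

Lemma future_lt rs Q : future rs Q -> all (fun v => v < n) Q.
Proof.
elim: Q rs => //= v Q IH rs [/E_lt[_ ->] _ /IH ->] //.
Qed.

Lemma walk_future i rs Q : walk i rs -> future rs Q ->
  walk (i + size Q) (catrev Q rs) /\
  nth n (catrev Q rs) 0 = last (nth n rs 0) Q.
Proof.
elim: Q i rs => [|v Q IH] i rs w /=; first by rewrite addn0.
by move=> [Ev fv fQ]; rewrite addnS -addSn; apply: IH fQ; apply: WalkS.
Qed.

(** The outcome of the detour argument. It concerns complete walks only, since a cycle is bounded in
    length only when its removal leaves an s-t walk. It justifies testing the full square of vertex
    pairs. *)
Hypothesis rigid : forall i rs, walk i rs -> nth n rs 0 = t -> i <= l ->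
  0 < K -> uniq rs.

Definition holds H f rs : Prop := forall k, k < D -> hist D H f k = nth n rs k.

Definition sound F H i : Prop := forall f, F f != 0 ->
  exists i' v q rs, [/\ i' <= i, v < n & q < D] /\
    [/\ f = slot i' v + q, walk i' rs, nth n rs 0 = v & holds H f rs].

Lemma sound_entry F H i i' v q : sound F H i -> v < n -> q < D ->
  F (slot i' v + q) != 0 ->
  i' <= i /\ exists rs, [/\ walk i' rs, nth n rs 0 = v & holds H (slot i' v + q) rs].
Proof.
move=> so vn qD /so[j [u [q1 [rs [[ji un q1D] [e w h0 ho]]]]]].
have [ij uv qq] := slot_inj vn un qD q1D e; subst.
by split=> //; exists rs.
Qed.

(** The stored walk takes over the very same continuation [Q], so that the first vertex of [Q] can
    be appended to it at the next level. *)
Definition good F H i : Prop := forall rs Q,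
  walk i rs -> future rs Q -> last (nth n rs 0) Q = t -> i + size Q <= l ->
  exists q rs', [/\ q < D, F (slot i (nth n rs 0) + q) != 0 &
    holds H (slot i (nth n rs 0) + q) rs'] /\
    [/\ walk i rs', nth n rs' 0 = nth n rs 0 & future rs' Q].

Definition flagged F (c : nat) : Prop :=
  (c = 1 \/ c = 0) /\
  (c = 1 <-> exists i q, q < D /\ F (slot i.+1 t + q) != 0).

(** The situation while level i + 1 is filled from level i: levels up to i are representative, level
    i + 1 is only sound and in echelon form. *)
Definition invariant F H X i c : Prop :=
  [/\ sound F H i.+1, forall v, v < n -> table F H X (slot i.+1 v),
      forall i', i' <= i -> good F H i' & flagged F c].

(** A slot records just the first D entries of a history, hence the quantification over all walks it
    may stand for. *)
Definition processed F H i u v q : Prop :=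
  F (slot i u + q) != 0 -> forall rs, holds H (slot i u + q) rs ->
  walk i rs -> fits (nth n rs) v ->
  covered F H (slot i.+1 v) (nth n (v :: rs)).

Definition inserted F H X c F' H' X' c' g v h : Prop :=
  [/\ F' = F, H' = H, X' = X & c' = c] \/
  exists q xv, [/\ q < D, stored D F H X F' H' X' (g + q) h xv &
                   c' = if v == t then 1 else c].

Lemma holds_stored F H X F' H' X' f h xv f' rs :
  stored D F H X F' H' X' f h xv -> f' != f -> holds H f' rs <-> holds H' f' rs.
Proof.
move=> [_ _ _ old] ff.
by split=> ho k kD; rewrite -(ho k kD) /hist (old _ _ ff kD).1.
Qed.

Lemma good_inserted F H X c F' H' X' c' i i' v h : v < n -> i < i' ->
  inserted F H X c F' H' X' c' (slot i' v) v h -> good F H i -> good F' H' i.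
Proof.
move=> vn ii; case=> [[-> -> _ _] //|[q [xv [qD sto _]]]] go rs Q w fQ lQ sQ.
have [q1 [rs' [[q1D F1 h1] [w' r0 fQ']]]] := go rs Q w fQ lQ sQ.
have un : nth n rs 0 < n.
  exact: walk_head w.
have nf : slot i (nth n rs 0) + q1 != slot i' v + q.
  by apply/eqP => /(slot_inj un vn q1D qD)[]; lia.
exists q1, rs'; split=> //; split=> //; last exact/(holds_stored _ sto).
by have [_ -> _ _] := sto; rewrite (negPf nf).
Qed.

Lemma processed_inserted F H X c F' H' X' c' i u v q v' h :
  u < n -> v' < n -> q < D ->
  inserted F H X c F' H' X' c' (slot i.+1 v') v' h ->
  processed F H i u v q -> processed F' H' i u v q.
Proof.
move=> un vn qD; case=> [[-> -> _ _] //|[q1 [xv [q1D sto _]]]] pr F1 rs h1 w fi.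
have nf : slot i u + q != slot i.+1 v' + q1.
  by apply/eqP => /(slot_inj un vn qD q1D)[]; lia.
apply: (stored_covered pp rD KD sto); apply: pr => //.
  by move: F1; have [_ -> _ _] := sto; rewrite (negPf nf).
exact/(holds_stored _ sto).
Qed.

Lemma invariant_inserted F H X c F' H' X' c' i v rs h :
  inserted F H X c F' H' X' c' (slot i.+1 v) v h ->
  invariant F H X i c -> table F' H' X' (slot i.+1 v) ->
  walk i.+1 (v :: rs) -> (forall k, k < D -> h k = nth n (v :: rs) k) ->
  invariant F' H' X' i c'.
Proof.
move=> ins [so ta go fl] tv w hE.
have vn : v < n by have /andP[] := walk_lt w.
have go' i' : i' <= i -> good F' H' i'.
  by move=> ii; apply: good_inserted ins (go _ ii).
case: ins => [[eF eH eX ec]|[q [xv [qD sto ec]]]]; first by subst.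
have [F0 FE new old] := sto.
split=> //.
- move=> f; rewrite FE; have [-> _|ff /so] := eqVneq f (slot i.+1 v + q).
    exists i.+1, v, q, (v :: rs); split=> //; split=> // k kD.
    by rewrite /hist (new k kD).1 hE.
  move=> [i' [v' [q' [rs' [h1 [h2 h3 h4 h5]]]]]].
  exists i', v', q', rs'; split=> //; split=> //.
  exact/(holds_stored _ sto ff).
- move=> u un; have [-> //|uv] := eqVneq u v.
  apply: (stored_table_other pp rD KD sto); last exact: ta.
  by move=> q' qD'; apply: contra uv => /eqP/(slot_inj un vn qD' qD)[_ ->].
- move: fl => [c01 cE]; split; rewrite ec; first by case: ifP; [left|].
  case: eqP => [vt|/eqP vt]; split=> //.
  + by move=> _; exists i, q; rewrite FE -vt eqxx.
  + move/cE=> [j [q' [qD' Fq']]]; exists j, q'; split=> //.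
    by rewrite FE; case: (_ =P slot i.+1 v + q).
  + move=> [j [q' [qD' Fq']]]; apply/cE; exists j, q'; split=> //.
    move: Fq'; rewrite FE; case: (_ =P slot i.+1 v + q) => // /(slot_inj tn vn qD' qD)[_ e _].
    by rewrite e eqxx in vt.
Qed.

(** The windows alone make the color factors nonzero. For the vertex factors, the whole walk
    [catrev Q rs] ends at t within length l, so [rigid] makes all pairs of the square differ. *)
Lemma future_test_neq0 i rs Q : walk i rs -> future rs Q ->
  last (nth n rs 0) Q = t -> i + size Q <= l -> test n r K cl p Q (nth n rs) != 0%R.
Proof.
move=> w fQ lQ sQ; have Qn := future_lt fQ.
apply/(test_neq0 _ _ cl_lt cl_n pp np) => //; first by move=> k; apply: walk_nth_le w.
move=> k j jQ; have El u v : E u v -> v < n by case/E_lt.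
have [_ f1 _] := future_fits (acc := [::]) El fQ k jQ.
split=> [kj|kK jK]; first by apply: f1; rewrite addn0.
have [wW hW] := walk_future w fQ; rewrite lQ in hW.
have un : uniq (catrev Q rs) by apply: rigid wW hW sQ _; lia.
have Qj : nth n Q j < n by apply: (all_nthP n Qn).
have [ks|ks] := ltnP k (size rs); last by rewrite (nth_default n ks); lia.
move: un; rewrite catrevE cat_uniq => /and3P[_ /hasPn/(_ _ (mem_nth n ks)) + _].
by rewrite mem_rev => /negP + e; rewrite -e mem_nth.
Qed.

(** Two exchanges. By [good] at level i, a stored history replaces the one before [v]; its extension
    by [v] has been processed, hence is covered. The test of [Q] is a linear functional that is
    nonzero at this extension, so it is nonzero at some history stored for [v], and a nonzero test
    means that [Q] continues that history too. *)
Lemma level_good F H X i c : invariant F H X i c ->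
  (forall u v q, E u v -> q < D -> processed F H i u v q) -> good F H i.+1.
Proof.
move=> [so ta go _] pr rs Q /walkS_inv[v [rs0 [-> w0 Ev fv]]] /= fQ lQ sQ.
have sQ' : i + size (v :: Q) <= l by rewrite /= addnS.
have [q [rs1 [[qD Fq hq] [w1 r0 f1]]]] :=
  go i (leqnn i) rs0 (v :: Q) w0 (And3 Ev fv fQ) lQ sQ'.
have [Ev1 fv1 fQ1] : [/\ E (nth n rs1 0) v, fits (nth n rs1) v & future (v :: rs1) Q] := f1.
have cov := pr _ _ _ Ev qD Fq rs1 hq w1 fv1.
have w1' : walk i.+1 (v :: rs1) by apply: WalkS.
have vn : v < n by case/E_lt: Ev.
have nz := future_test_neq0 w1' fQ1 lQ sQ.
have [w wE] : Lin (p := p) r K cl D (test n r K cl p Q).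
  by apply: (Lin_Mix cl pp RD r0K); rewrite size_mkseq.
pose g := slot i.+1 v.
have [|no] := boolP [exists q' : 'I_D, (F (g + q') != 0) &&
    (pairing D w (phi p r K cl (hist D H (g + q'))) != 0%R)].
  case/existsP=> q' /andP[Fq' nz'].
  have [_ [rs2 [w2 h2 ho2]]] := sound_entry so vn (ltn_ord q') Fq'.
  exists q', rs2; split=> //; split=> //.
  have : test n r K cl p Q (nth n rs2) != 0%R.
    rewrite /test -(Mix_ext cl pp rD KD _ _ ho2) -/(test n r K cl p Q _) wE.
    exact: nz'.
  move/(test_neq0 _ _ cl_lt cl_n pp np
    (fun k => walk_nth_le k w2) (future_lt fQ1)) => nd.
  have El u u' : E u u' -> u' < n by case/E_lt.
  apply: (future_swap (acc := [::]) cl_n fQ1) => //= k j jQ; rewrite addn0 => kj.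
    exact: (nd k j jQ).1.
  by apply: (nd k j jQ).2; lia.
case/eqP: nz; rewrite wE; apply: cov => q' qD' Fq'.
move/existsPn: no => /(_ (Ordinal qD')); rewrite Fq' /= => /negPn/eqP.
by [].
Qed.

Lemma invariant_next F H X i c : invariant F H X i c ->
  (forall u v q, E u v -> q < D -> processed F H i u v q) ->
  sound F H i.+1 /\ invariant F H X i.+1 c.
Proof.
move=> inv pr; have gi := level_good inv pr.
have [so ta go fl] := inv; split=> //; split=> //.
- move=> f /so[i' [v [q [rs [[h1 h2 h3] h4]]]]].
  by exists i', v, q, rs; split=> //; split=> //; lia.
- move=> v vn.
  (* By soundness the next level is still empty, so its tables are trivially valid. *)
  have F0 q : q < D -> F (slot i.+2 v + q) = 0.
    move=> qD; apply/eqP; apply: contraT => /(sound_entry so vn qD)[]; lia.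
  by split=> [q qD|w _ q qD]; rewrite F0.
- by move=> i'; rewrite leq_eqVlt => /orP[/eqP->|/go].
Qed.

Lemma invariant_init F H X : (forall f, F f = (f == slot 0 s)) ->
  holds H (slot 0 s) [:: s] ->
  sound F H 0 /\ invariant F H X 0 0.
Proof.
move=> FE hs; have D0 : 0 < D by lia.
have e0 v q i : v < n -> q < D -> F (slot i.+1 v + q) = 0.
  move=> vn qD; rewrite FE; case: eqP => //.
  by rewrite -[slot 0 s]addn0 => /(slot_inj vn sn qD D0)[].
have s0 i : sound F H i.
  move=> f; rewrite FE; case: (f =P slot 0 s) => // -> _.
  exists 0, s, 0, [:: s]; split=> //; split=> //; first by rewrite addn0.
  exact: Walk0.
split=> //; split=> //.
- by move=> v vn; split=> [q qD|w _ q qD]; rewrite e0.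
- move=> i; rewrite leqn0 => /eqP -> rs Q w fQ _ _.
  have e : rs = [:: s].
    by inversion w.
  rewrite e /= in fQ *; exists 0, [:: s]; rewrite addn0 FE eqxx.
  by split=> //; split=> //; apply: Walk0.
- split; first by right.
  by split=> // -[i [q [qD]]]; rewrite e0.
Qed.

(** Completeness is [good] for the empty continuation. As s != t, the walk is not at level 0, which
    the flag does not watch. *)
Lemma invariant_final F H X c : sound F H l -> invariant F H X l c ->
  (c = 1 \/ c = 0) /\
  (c = 1 <-> exists i rs, [/\ i <= l, walk i rs & nth n rs 0 = t]).
Proof.
move=> so [_ _ go [c01 cE]]; split=> //; split=> [/cE|].
  move=> [i [q [qD Fq]]]; have [il [rs [w r0 _]]] := sound_entry so tn qD Fq.
  by exists i.+1, rs.
move=> [i [rs [il w r0]]]; apply/cE.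
have [||q [rs' [[qD Fq ho] [w' r0' _]]]] := go i il rs [::] w I; rewrite ?addn0 //.
case: i {go il ho} w w' Fq => [|i] w w' Fq.
  by inversion w; subst rs; case/eqP: (st).
by exists i, q; rewrite -r0.
Qed.
End Search.

(** * Gaussian elimination on the machine *)

(** Lacking multiplication, addresses that are multiples of D are formed by D additions. *)
Definition AddMul (x y : nat) : program :=
  For 34 (Reg 8) (x ::= Add (Reg x) (Reg y)).

Lemma wp_AddMul x y st D a b : x != y -> x != 34 -> y != 34 -> x != 8 ->
  reg st 8 = D -> reg st x = a -> reg st y = b ->
  wp (AddMul x y) st (fun st' T => reg st' x = a + D * b /\ T <= 20 * D.+1).
Proof.
move=> xy x34 y34 x8 rD rx ry.
apply: (@wp_for _ _ _ _ D 4 (fun j st' => reg st' x = a + j * b)) => //.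
- by rewrite /= inE eq_sym.
- by rewrite /= !inE /= orbF eq_sym.
- by rewrite /= (negPf x34) rx addn0.
- move=> j st1 jD ag _ Ij; apply: wp_set; split=> //=.
  rewrite (negPf x34) eqxx Ij.
  have -> : reg st1 y = b.
    apply: agree_reg ag ry _.
    by rewrite /= !inE !(negPf y34) orbF /= eq_sym.
  by rewrite mulSn -addnA [b + _]addnC.
by move=> st2 T ag _ I2 TB; split=> //; move: TB => /=; lia.
Qed.

Definition Reduce : program :=
  If (Sub (Add (Reg 20) (Const 1)) (Reg 9)) (20 ::= Sub (Reg 20) (Reg 9)) Skip.

Lemma wp_Reduce st p a : prime p -> reg st 9 = p -> reg st 20 = a -> a < p + p ->
  wp Reduce st (fun st' T =>
    [/\ reg st' 20 < p, ((reg st' 20)%:R = a%:R :> 'F_p)%R & T <= 20]).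
Proof.
move=> pp rp ra ap; apply: wp_if => /=; rw => h.
  apply: wp_set; split=> //=; rw; first by lia.
  have pa : p <= a by lia.
  have := Fp_natrB pp (leqnn p); rewrite subnn => /esym/eqP; rewrite oppr_eq0.
  by move=> /eqP p0; rewrite natrB // p0 subr0.
by apply: wp_skip; rw; split=> //; lia.
Qed.

(** Both coefficients are saved beforehand, because the loop overwrites array 11 including the entry
    at the pivot. The negative one is represented by its complement to p. *)
Definition Eliminate : program :=
  40 ::= Get 7 (Add (Reg 35) (Reg 38)) ;;
  41 ::= Sub (Reg 9) (Get 11 (Reg 38)) ;;
  For 34 (Reg 8) (
    20 ::= Get 11 (Reg 34) ;;
    21 ::= Reg 40 ;;
    MulMod ;;
    42 ::= Reg 20 ;;
    20 ::= Get 7 (Add (Reg 35) (Reg 34)) ;;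
    21 ::= Reg 41 ;;
    MulMod ;;
    20 ::= Add (Reg 20) (Reg 42) ;;
    Reduce ;;
    SetArr 11 (Reg 34) (Reg 20)).

Lemma wp_Eliminate st D p f q xv X : prime p ->
  reg st 8 = D -> reg st 9 = p -> reg st 35 = f * D -> reg st 38 = q ->
  arr st 11 = xv -> arr st 7 = X -> q < D ->
  (forall x, x < D -> xv x < p) -> (forall x, x < D -> X (f * D + x) < p) ->
  wp Eliminate st (fun st' T =>
    [/\ forall x, x < D -> arr st' 11 x < p,
        forall x, x < D -> ((arr st' 11 x)%:R =
          (X (f * D + q))%:R * (xv x)%:R - (xv q)%:R * (X (f * D + x))%:R :> 'F_p)%R &
        T <= 220 * (D * p.+1)]).
Proof.
move=> pp rD rp r35 r38 a11 a7 qD xp Xp; have p0 := prime_gt0 pp.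
do 2!seqset.
apply: (@wp_for _ _ _ _ D (150 * p.+1) (fun j st' =>
  [/\ forall x, j <= x < D -> arr st' 11 x = xv x,
      forall x, x < j -> arr st' 11 x < p &
      forall x, x < j -> ((arr st' 11 x)%:R =
          (X (f * D + q))%:R * (xv x)%:R - (xv q)%:R * (X (f * D + x))%:R :> 'F_p)%R])) => //=.
- by split=> // x _; rw.
- move=> j st1 jD ag rj [I1 I2 I3].
  have [r40 r41] : reg st1 40 = X (f * D + q) /\ reg st1 41 = p - xv q.
    by split; rewrite ag.1 //=; rw.
  fr ag.
  have bj : xv q <= p by apply/ltnW/xp.
  seqset; rewrite I1 ?leqnn //; seqset.
  apply/wp_seq/wp_conseq; first exact: (@wp_MulMod _ p (xv j) (X (f * D + q)) _ _ _ (xp j jD)).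
  move=> st2 T2 ag2 [r20 T2B]; have r11 : arr st2 11 = arr st1 11 by rewrite ag2.2.
  fr ag2; do 3!seqset.
  apply/wp_seq/wp_conseq.
    exact: (@wp_MulMod _ p (X (f * D + j)) (p - xv q) _ _ _ (Xp j jD)).
  move=> st3 T3 ag3 [r20' T3B].
  have r42 : reg st3 42 = (xv j * X (f * D + q)) %% p by rewrite ag3.1.
  have r11' : arr st3 11 = arr st1 11 by rewrite ag3.2.
  fr ag3.
  set u := (xv j * _) %% p in r42; set v := (X _ * _) %% p in r20'.
  have [up vp] : u < p /\ v < p by rewrite !ltn_pmod.
  have uv : ((u + v)%:R = (X (f * D + q))%:R * (xv j)%:R -
      (xv q)%:R * (X (f * D + j))%:R :> 'F_p)%R.
    by rewrite natrD !Fp_natr_modn // !natrM Fp_natrB //; ring.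
  have TT : T2 + T3 <= 80 * p.+1.
    have := Xp q qD; lia.
  seqset; apply/wp_seq/wp_conseq.
    by apply: (@wp_Reduce _ p (v + u)) => //=; rw => //; lia.
  move=> st4 T4 ag4 [r20'' v20 T4B].
  have r34 : reg st4 34 = j by rewrite ag4.1 //= ag3.1 // ag2.1.
  have r11'' : arr st4 11 = arr st1 11 by rewrite ag4.2.
  apply: wp_arr; split=> /=; first by clear -TT T4B; lia.
  rewrite /= r34 r11''; split=> x.
  - move=> /andP[jx xD]; have /negPf -> : x != j by apply: contraTneq jx => ->; rewrite ltnn.
    by apply: I1; rewrite ltnW.
  - by rewrite ltnS leq_eqVlt; case: eqP => //= _; apply: I2.
  - rewrite ltnS leq_eqVlt; case: eqP => /= [-> _|_]; last exact: I3.
    by rewrite v20 addnC.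
move=> st2 T2 ag _ [I1 I2 I3] TB; split=> //.
have pD : 0 < D by lia.
move: TB => /=; nia.
Qed.

Lemma cell_inj D f k f' k' : k < D -> k' < D -> f * D + k = f' * D + k' ->
  f = f' /\ k = k'.
Proof.
move=> kD kD' e; have D0 : 0 < D by lia.
have := congr1 (divn^~ D) e; rewrite !divnMDl // !divn_small // !addn0 => ff.
by split=> //; lia.
Qed.

Definition Store : program :=
  SetArr 8 (Reg 39) (Const 1) ;;
  For 34 (Reg 8) (
    SetArr 7 (Add (Reg 35) (Reg 34)) (Get 11 (Reg 34)) ;;
    SetArr 6 (Add (Reg 35) (Reg 34)) (Get 9 (Reg 34))) ;;
  37 ::= Const 0 ;;
  If (Add (Sub (Reg 18) (Reg 3)) (Sub (Reg 3) (Reg 18))) Skip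
    (10 ::= Const 1).

Lemma wp_Store st D F H X f h xv v t c :
  reg st 8 = D -> reg st 35 = f * D -> reg st 39 = f -> reg st 18 = v ->
  reg st 3 = t -> reg st 10 = c -> arr st 8 = F -> arr st 6 = H ->
  arr st 7 = X -> arr st 9 = h -> arr st 11 = xv -> F f = 0 ->
  wp Store st (fun st' T =>
    [/\ stored D F H X (arr st' 8) (arr st' 6) (arr st' 7) f h xv,
        reg st' 37 = 0, reg st' 10 = if v == t then 1 else c & T <= 60 * D.+1]).
Proof.
move=> rD r35 r39 r18 r3 r10 a8 a6 a7 a9 a11 F0.
apply/wp_seq/wp_arr; rewrite /= r39; apply: wp_seq.
have r10' : reg st 10 = c by [].
apply: (@wp_for _ _ _ _ D 20 (fun j st' =>
  [/\ forall k, k < j -> arr st' 6 (f * D + k) = h k /\ arr st' 7 (f * D + k) = xv k,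
      forall f' k, f' != f -> k < D -> arr st' 6 (f' * D + k) = H (f' * D + k) /\
         arr st' 7 (f' * D + k) = X (f' * D + k) &
      forall f', arr st' 8 f' = if f' == f then 1 else F f'])) => //=.
- by split=> //; rw.
- move=> j st1 jD ag rj [I1 I2 I3]; fr ag.
  apply/wp_seq/wp_arr/wp_arr; split=> //=; rw; split=> //.
  + move=> k; rewrite ltnS leq_eqVlt; case: eqP => [->|nk] /= kj; first by rewrite eqxx.
    case: eqP => [/(cell_inj (ltn_trans kj jD) jD)[] //|_]; exact: I1.
  + move=> f' k ff kD.
    case: eqP => [/(cell_inj kD jD)[e _]|_]; last exact: I2.
    by rewrite e eqxx in ff.
move=> st2 T ag _ [I1 I2 I3] TB; fr ag; seqset.
by apply: wp_if => /=; rw => h0; [apply: wp_skip|apply: wp_set];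
  (split; [by split|by []|rewrite /=; case: eqP => // vt; lia|move: TB => /=; lia]).
Qed.

(* Division free: eliminating with pivot q multiplies the vector by the nonzero
   pivot entry of the stored one.  Register 37 is zero once the remainder has
   been stored. *)
Definition Insert : program :=
  37 ::= Const 1 ;;
  For 38 (Reg 8) (
    If (Reg 37)
      (If (Get 11 (Reg 38)) (
        39 ::= Add (Reg 19) (Reg 38) ;;
        35 ::= Const 0 ;;
        AddMul 35 39 ;;
        If (Get 8 (Reg 39)) Eliminate Store) Skip)
      Skip).

Lemma wp_Insert st p r K D cl F H X g h xv v t c :
  prime p -> r < D -> K < D ->
  reg st 8 = D -> reg st 9 = p -> reg st 19 = g -> reg st 18 = v ->
  reg st 3 = t -> reg st 10 = c -> arr st 8 = F -> arr st 6 = H ->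
  arr st 7 = X -> arr st 9 = h -> arr st 11 = xv ->
  (forall x, x < D -> xv x < p) ->
  (forall x, x < D -> ((xv x)%:R = phi p r K cl h x)%R) ->
  table p r K D cl F H X g ->
  wp Insert st (fun st' T =>
    [/\ table p r K D cl (arr st' 8) (arr st' 6) (arr st' 7) g,
        covered p r K D cl (arr st' 8) (arr st' 6) g h,
        inserted D t F H X c (arr st' 8) (arr st' 6) (arr st' 7) (reg st' 10) g v h &
        T <= 400 * (D * (D * p.+1))]).
Proof.
move=> pp rD KD r8 r9 r19 r18 r3 r10 a8 a6 a7 a9 a11 xp xE tab.
seqset.
(* While register 37 is 1 the tables are the initial ones and array 11 is reduced below column q;
   once it is 0 the tables are final. *)
apply: (@wp_for _ _ _ _ D (300 * (D * p.+1)) (fun q st' =>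
  (reg st' 37 = 1 /\ [/\ arr st' 8 = F, arr st' 6 = H, arr st' 7 = X, reg st' 10 = c &
     reduced p r K D cl F H g h (arr st' 11) q]) \/
  (reg st' 37 = 0 /\ [/\ table p r K D cl (arr st' 8) (arr st' 6) (arr st' 7) g,
      covered p r K D cl (arr st' 8) (arr st' 6) g h &
      exists q xv, [/\ q < D, stored D F H X (arr st' 8) (arr st' 6) (arr st' 7) (g + q) h xv &
        reg st' 10 = if v == t then 1 else c]]))) => //=.
- by left; split=> //; split=> //; rewrite a11; apply: reduced_init.
- move=> q st1 qD ag rq [[go [b8 b6 b7 b10 red]]|[go rest]]; last first.
    have D0 : 0 < D * p.+1 by rewrite muln_gt0; lia.
    apply: wp_if; rewrite /= go // => _; apply: wp_skip; split=> /=; first by lia.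
    by right; rewrite /= go.
  have [r81 r91 r191 r181 r31] : [/\ reg st1 8 = D, reg st1 9 = p, reg st1 19 = g,
      reg st1 18 = v & reg st1 3 = t].
    by split; rewrite ag.1.
  have b9 : arr st1 9 = h by rewrite ag.2.
  have D0 : D <= D * p.+1 by rewrite leq_pmulr.
  apply: wp_if; rewrite /= go // => _; apply: wp_if => /=; rw => x0; last first.
    apply: wp_skip; split=> /=; first by lia.
    by left; split=> //; split=> //; apply: reduced_skip.
  have [xv' xvE] : exists xv', arr st1 11 = xv' by eexists.
  rewrite xvE in red x0.
  clear r8 r9 r19 r18 r3 r10 a8 a6 a7 a9 a11.
  do 2!seqset; apply/wp_seq/wp_conseq.
    exact: (@wp_AddMul 35 39 _ D 0 (g + q)).
  move=> st2 T2 ag2 [r35 T2B]; rewrite add0n mulnC in r35.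
  have r39 : reg st2 39 = g + q by rewrite ag2.1.
  fr ag2.
  apply: wp_if => /=; rw => Fq.
    have [[ec sp] [x1 x2 x3]] := (tab, red).
    apply: wp_conseq.
      apply: (@wp_Eliminate _ D p (g + q) q xv' X) => //.
      by have [] := ec q qD Fq.
    move=> st3 T3 ag3 [y1 y2 T3B].
    fr ag3; split=> /=; first by clear -T2B T3B D0 qD; lia.
    left; split=> //; split=> //.
    exact: (reduced_step pp rD KD qD tab Fq red y1 y2).
  apply: wp_conseq.
    by apply: (@wp_Store _ D F H X (g + q) h xv' v t c).
  move=> st3 T3 ag3 [sto go3 c3 T3B].
  split=> /=; first by clear -T2B T3B D0 qD; lia.
  right; split=> //.
  have [t3 cov3] := stored_table pp rD KD qD sto tab red x0.
  by split=> //; exists q, xv'.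
move=> st2 T ag _ I TB.
have TB' : T + 2 <= 400 * (D * (D * p.+1)).
  have D0 : D <= D * p.+1 by rewrite leq_pmulr.
  by move: TB => /=; nia.
case: I => [[_ [-> -> -> -> red]]|[_ [t2 c2 [q [xv' [qD sto c']]]]]].
  split=> //; first exact: reduced_covered red.
    by left.
  by lia.
by split=> //; [right; exists q, xv'|lia].
Qed.

(** * Extending one stored history by one arc *)

Definition Window : program :=
  35 ::= Const 0 ;;
  AddMul 35 43 ;;
  SetArr 9 (Const 0) (Reg 18) ;;
  SetArr 10 (Const 0) (Get 5 (Reg 18)) ;;
  For 34 (Reg 8) (
    SetArr 9 (Add (Reg 34) (Const 1)) (Get 6 (Add (Reg 35) (Reg 34))) ;;
    SetArr 10 (Add (Reg 34) (Const 1))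
      (Get 5 (Get 6 (Add (Reg 35) (Reg 34))))).

Lemma wp_Window st n D e v cl H rs :
  reg st 8 = D -> reg st 43 = e -> reg st 18 = v -> arr st 5 = cl ->
  arr st 6 = H -> holds n D H e rs ->
  wp Window st (fun st' T =>
    [/\ forall k, k <= D -> arr st' 9 k = nth n (v :: rs) k,
        forall k, k <= D -> arr st' 10 k = cl (nth n (v :: rs) k) &
        T <= 60 * D.+1]).
Proof.
move=> r8 r43 r18 a5 a6 ho; seqset; apply/wp_seq/wp_conseq.
  exact: (@wp_AddMul 35 43 _ D 0 e).
move=> st2 T2 ag2 [r35 T2B]; rewrite add0n mulnC in r35; fr ag2.
apply/wp_seq/wp_arr => /=; apply/wp_seq/wp_arr => /=; rw.
apply: (@wp_for _ _ _ _ D 22 (fun j st' =>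
   (forall k, k <= j -> arr st' 9 k = nth n (v :: rs) k) /\
   (forall k, k <= j -> arr st' 10 k = cl (nth n (v :: rs) k)))) => //=.
- by split=> k; rewrite leqn0 => /eqP ->.
- move=> j st1 jD ag rj [I1 I2].
  have [b5 b6 r35'] : [/\ arr st1 5 = cl, arr st1 6 = H & reg st1 35 = e * D].
    by split; [rewrite ag.2|rewrite ag.2|rewrite ag.1].
  apply/wp_seq/wp_arr/wp_arr; split=> //=; rw; rewrite addn1 -/(hist D H e j) (ho j jD).
  split=> k; rewrite leq_eqVlt ltnS; case: (k =P j.+1) => [->|_] //=.
    exact: I1.
  exact: I2.
by move=> st3 T3 ag3 _ [I1 I2] TB; split=> //; move: TB => /=; lia.
Qed.

Definition Neq (e1 e2 : expr) : expr := Add (Sub e1 e2) (Sub e2 e1).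

Lemma Neq_eq0 st e1 e2 : (eval st (Neq e1 e2) = 0) <-> (eval st e1 = eval st e2).
Proof. by rewrite /=; lia. Qed.

Definition Fresh (a y : nat) : program :=
  For 34 (Reg y) (
    If (Neq (Get a (Add (Reg 34) (Const 1))) (Get a (Const 0))) Skip
      (36 ::= Const 0)).

Lemma wp_Fresh a y st m c f : y \notin [:: 34; 36] ->
  reg st y = m -> reg st 36 = c -> arr st a = f ->
  wp (Fresh a y) st (fun st' T =>
    (reg st' 36 = c /\ (forall k, k < m -> f 0 <> f k.+1) \/
     reg st' 36 = 0 /\ exists2 k, k < m & f 0 = f k.+1) /\
    T <= 30 * m.+1).
Proof.
move=> yn ry r36 af.
apply: (@wp_for _ _ _ _ m 20 (fun j st' =>
   (reg st' 36 = c /\ (forall k, k < j -> f 0 <> f k.+1) \/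
     reg st' 36 = 0 /\ exists2 k, k < j & f 0 = f k.+1))) => //=.
- by move: yn; rewrite !inE; case: (y == 34) => //=; case: (y == 36).
- by left; split.
- move=> j st1 jm ag rj I.
  have b : arr st1 a = f by rewrite ag.2.
  apply: wp_if => [e|/Neq_eq0 e].
    apply: wp_skip; split=> //=.
    have {}e : f 0 <> f j.+1.
      by move=> e0; move/eqP: e; apply; apply/Neq_eq0; rewrite /= rj b addn1.
    case: I => [[r1 h1]|[r0 [k kj hk]]]; [left|right]; split=> //.
      by move=> k; rewrite ltnS leq_eqVlt => /orP[/eqP -> //|/h1].
    by exists k => //; apply: ltnW.
  apply: wp_set; split=> //=; right; split=> //; exists j => //.
  by move: e; rewrite /= rj b addn1.
move=> st2 T ag _ I TB; split=> //; move: TB => /=; lia.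
Qed.

Definition Vector : program :=
  For 31 (Reg 8) (Phi ;; SetArr 11 (Reg 31) (Reg 20)).

Lemma wp_Vector st n p r K D cl h g : prime p -> n < p ->
  reg st 9 = p -> reg st 4 = r -> reg st 7 = K -> reg st 11 = r.+1 ->
  reg st 8 = D -> arr st 9 = h -> arr st 10 = g ->
  r < D -> K < D ->
  (forall i, i < D -> h i <= n) -> (forall i, i < D -> g i <= n) ->
  (forall i, i < D -> g i = cl (h i)) ->
  wp Vector st (fun st' T =>
    [/\ forall x, x < D -> arr st' 11 x < p,
        forall x, x < D -> ((arr st' 11 x)%:R = phi p r K cl h x)%R &
        T <= 1020 * (D * (D * D * (p + D + D)))]).
Proof.
move=> pp np r9 r4 r7 r11 r8 a9 a10 rD KD hn gn gh.
apply: (@wp_for _ _ _ _ D (1003 * (D * D * (p + D + D))) (fun j st' =>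
   (forall x, x < j -> arr st' 11 x < p) /\
   (forall x, x < j -> ((arr st' 11 x)%:R = phi p r K cl h x)%R))) => //=.
- move=> j st1 jD ag rj [I1 I2]; fr ag.
  apply/wp_seq/wp_conseq.
    by apply: (@wp_Phi _ n p r K D cl j h g).
  move=> st2 T2 ag2 [x1 x2 TB]; have b11 : arr st2 11 = arr st1 11 by rewrite ag2.2.
  fr ag2; apply: wp_arr; split=> /=.
    have : 0 < D * D * (p + D + D) by rewrite !muln_gt0; lia.
    by clear -TB; lia.
  rw; split=> x; rewrite ltnS leq_eqVlt; case: (x =P j) => [->|_] //=; auto.
move=> st2 T ag _ [I1 I2] TB; split=> //.
have : 0 < D * D * (p + D + D) by rewrite !muln_gt0; lia.
by move: TB => /=; move: (D * D * _) => Y; clear -rD; nia.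
Qed.

Definition Candidate : program :=
  Window ;;
  36 ::= Const 1 ;;
  Fresh 10 4 ;;
  Fresh 9 7 ;;
  If (Reg 36) (Vector ;; Insert) Skip.

Lemma wp_Candidate st n p r K D cl F H X g v t c e rs :
  prime p -> n < p -> r < D -> K < D -> v < n ->
  reg st 4 = r -> reg st 7 = K -> reg st 11 = r.+1 ->
  reg st 8 = D -> reg st 9 = p -> reg st 19 = g -> reg st 18 = v ->
  reg st 3 = t -> reg st 10 = c -> reg st 43 = e -> arr st 5 = cl ->
  arr st 8 = F -> arr st 6 = H -> arr st 7 = X ->
  holds n D H e rs -> (forall k, nth n rs k <= n) ->
  (forall u, u <= n -> cl u <= n) ->
  table p r K D cl F H X g ->
  wp Candidate st (fun st' T =>
    T <= 2000 * (D * (D * D * (p + D + D))) /\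
    ((fits r K cl (nth n rs) v /\
      [/\ table p r K D cl (arr st' 8) (arr st' 6) (arr st' 7) g,
        covered p r K D cl (arr st' 8) (arr st' 6) g (nth n (v :: rs)) &
        exists2 h, (forall k, k < D -> h k = nth n (v :: rs) k) &
        inserted D t F H X c (arr st' 8) (arr st' 6) (arr st' 7) (reg st' 10) g v h]) \/
     (~ fits r K cl (nth n rs) v /\
      [/\ arr st' 8 = F, arr st' 6 = H, arr st' 7 = X & reg st' 10 = c]))).
Proof.
move=> pp np rD KD vn r4 r7 r11 r8 r9 r19 r18 r3 r10 r43 a5 a8 a6 a7 ho rsn cln tab.
have [Y YE] : exists Y, Y = D * (D * D * (p + D + D)) by eexists.
have DY : D <= Y by rewrite YE leq_pmulr // !muln_gt0; lia.
have IY : D * (D * p.+1) <= Y.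
  rewrite YE -[D * D * _]mulnA !leq_pmul2l ?(leq_trans _ KD) //.
  by apply: (@leq_trans (p + D + D)); [|rewrite leq_pmull]; lia.
rewrite -YE.
apply/wp_seq/wp_conseq; first exact: (@wp_Window _ n D e v cl H rs).
move=> st1 T1 ag1 [w9 w10 T1B]; fr ag1; seqset.
have [h a9] : exists h, arr st1 9 = h by eexists.
have [gc a10] : exists gc, arr st1 10 = gc by eexists.
rewrite a9 in w9; rewrite a10 in w10.
apply/wp_seq/wp_conseq; first exact: (@wp_Fresh 10 4 _ r 1 gc).
move=> st2 T2 ag2 [F1 T2B]; fr ag2.
apply/wp_seq/wp_conseq; first exact: (@wp_Fresh 9 7 _ K (reg st2 36) h).
move=> st3 T3 ag3 [F2 T3B]; fr ag3.
have wc k : k < r -> gc k.+1 = cl (nth n rs k) by move=> kr; rewrite w10 //; lia.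
have wh k : k < K -> h k.+1 = nth n rs k by move=> kr; rewrite w9 //; lia.
have [wc0 wh0] : gc 0 = cl v /\ h 0 = v by rewrite w10 // w9.
apply: wp_if => /= r36; last first.
  apply: wp_skip; split=> /=; first by clear -T1B T2B T3B DY rD KD; lia.
  right; split=> // -[f1 f2]; case: F1 => [[e1 _]|[_ [k kr e1]]]; last first.
    by apply: (f1 k kr); rewrite -wc // -wc0.
  case: F2 => [[e2 _]|[_ [k kr e2]]]; last by apply: (f2 k kr); rewrite -wh // -wh0.
  by rewrite e2 e1 in r36.
have fi : fits r K cl (nth n rs) v.
  case: F1 => [[_ F1]|[e1 _]]; case: F2 => [[e2 F2]|[e2 _]]; rewrite ?e2 // ?e1 // in r36.
  by split=> k kr; [rewrite -wc // -wc0; apply: F1|rewrite -wh // -wh0; apply: F2].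
have hn k : k < D -> h k <= n.
  by move=> kD; rewrite w9 ?(ltnW kD) //; case: k {kD} => [|k] //=; apply: ltnW.
have cE k : k < D -> gc k = cl (h k) by move=> kD; rewrite w10 ?w9 // ltnW.
apply/wp_seq/wp_conseq.
  apply: (@wp_Vector _ n p r K D cl h gc) => //.
  by move=> k kD; rewrite cE // cln // hn.
move=> st4 T4 ag4 [x1 x2 T4B]; fr ag4.
apply: wp_conseq.
  exact: (@wp_Insert _ p r K D cl F H X g h _ v t c).
move=> st5 T5 ag5 [t5 c5 i5 T5B]; split=> /=.
  by rewrite -YE in T4B; clear -T1B T2B T3B DY rD KD T4B T5B IY; lia.
left; split=> //; split=> //; last by exists h => // k kD; rewrite w9 // ltnW.
move=> w /c5 <-; apply: pairing_ext => x _; apply: (phi_ext _ pp rD KD) => k kD.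
by rewrite w9 // ltnW.
Qed.

(** * The search over all levels as a program *)

Definition ArcStep : program :=
  17 ::= Reg 12 ;;
  44 ::= Get 0 (Reg 15) ;;
  AddMul 17 44 ;;
  18 ::= Get 1 (Reg 15) ;;
  19 ::= Reg 13 ;;
  AddMul 19 18 ;;
  For 16 (Reg 8) (
    43 ::= Add (Reg 17) (Reg 16) ;;
    If (Get 8 (Reg 43)) Candidate Skip).

Definition Level : program :=
  13 ::= Reg 12 ;;
  AddMul 13 0 ;;
  For 15 (Reg 1) ArcStep ;;
  12 ::= Reg 13.

(** The only history of level 0 is s followed by dummies n, which register 0 supplies. It occupies
    its slot without a vector, since nothing is ever reduced against level 0. *)
Definition Search : program :=
  43 ::= Const 0 ;;
  AddMul 43 2 ;;
  35 ::= Const 0 ;;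
  AddMul 35 43 ;;
  For 34 (Reg 8) (SetArr 6 (Add (Reg 35) (Reg 34)) (Reg 0)) ;;
  SetArr 6 (Reg 35) (Reg 2) ;;
  SetArr 8 (Reg 43) (Const 1) ;;
  10 ::= Const 0 ;;
  12 ::= Const 0 ;;
  For 14 (Reg 5) Level.

Section SearchRun.
Variables (p n m r K D : nat) (cl tl hd : nat -> nat) (s t l : nat).
Let E u v := exists2 j, j < m & tl j = u /\ hd j = v.
Hypotheses (pp : prime p) (np : n.+1 < p) (rD : r < D) (KD : K < D).
Hypothesis RD : r.+1 ^ (r + (K + K)) <= D.
Hypothesis r0K : 0 < K -> 0 < r.
Hypotheses (sn : s < n) (tn : t < n) (sNt : s != t).
Hypothesis tlhd : forall j, j < m -> tl j < n /\ hd j < n.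
Hypothesis cl_lt : forall v, v < n -> cl v < n.
Hypothesis cl_n : cl n = n.
Hypothesis rigid : forall i rs, walk n r K cl E s i rs -> nth n rs 0 = t ->
  i <= l -> 0 < K -> uniq rs.
Local Notation invariant := (invariant p n r K D cl E s t l).
Local Notation processed := (processed p n r K D cl E s).
Local Notation slot := (slot n D).

Lemma E_lt u v : E u v -> u < n /\ v < n.
Proof. by move=> [j /tlhd + [<- <-]]. Qed.

Lemma holds_inserted F H X c F' H' X' c' i u v q h rs : u < n -> v < n -> q < D ->
  inserted D t F H X c F' H' X' c' (slot i.+1 v) v h ->
  holds n D H (slot i u + q) rs -> holds n D H' (slot i u + q) rs.
Proof.
move=> un vn qD; case=> [[_ -> _ _] //|[q1 [xv [q1D sto _]]]] ho.
apply/(holds_stored _ _ sto) => //.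
by apply/eqP => /(slot_inj un vn qD q1D)[]; lia.
Qed.

Lemma processed_intro F H i u v q rs : holds n D H (slot i u + q) rs ->
  (fits r K cl (nth n rs) v ->
     covered p r K D cl F H (slot i.+1 v) (nth n (v :: rs))) ->
  processed F H i u v q.
Proof.
move=> ho cov _ rs' ho' _ [f1 f2].
have e k : k < D -> nth n rs k = nth n rs' k by move=> kD; rewrite -ho // -ho'.
have fi : fits r K cl (nth n rs) v.
  by split=> k kr; rewrite e; [apply: f1|lia|apply: f2|lia].
move=> w /(cov fi) <-; apply: pairing_ext => x _; apply: (phi_ext _ pp rD KD).
by case=> //= k kD; rewrite e // ltnW.
Qed.

Record ctx st : Prop := Ctx {
  ctx0 : reg st 0 = n; ctx1 : reg st 1 = m; ctx2 : reg st 2 = s;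
  ctx3 : reg st 3 = t; ctx4 : reg st 4 = r; ctx5 : reg st 5 = l;
  ctx7 : reg st 7 = K; ctx8 : reg st 8 = D; ctx9 : reg st 9 = p;
  ctx11 : reg st 11 = r.+1; ctxt : arr st 0 = tl; ctxh : arr st 1 = hd;
  ctxc : arr st 5 = cl }.

Definition inv st i := invariant (arr st 8) (arr st 6) (arr st 7) i (reg st 10).
Definition proc st i u v q := processed (arr st 8) (arr st 6) i u v q.

(** The order of the time per arc and level: D slots, each requiring a vector of D entries that cost
    D * D * (p + D + D) apiece. *)
Let W := D * (D * (D * D * (p + D + D))).

Lemma ctx_agree P st st' : agree P st st' ->
  ~~ has (mem (wreg P)) [:: 0; 1; 2; 3; 4; 5; 7; 8; 9; 11] ->
  ~~ has (mem (warr P)) [:: 0; 1; 5] -> ctx st -> ctx st'.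
Proof.
move=> [ag ag'] /hasPn nr /hasPn na [*].
by split; rewrite ?ag ?ag' ?nr ?na.
Qed.

Lemma D_gt0 : 0 < D. Proof. exact: leq_ltn_trans rD. Qed.

Lemma wp_ArcStep st0 i j : ctx st0 -> reg st0 12 = slot i 0 ->
  reg st0 13 = slot i.+1 0 -> reg st0 15 = j -> j < m -> inv st0 i ->
  wp ArcStep st0 (fun st' T =>
    [/\ inv st' i, forall q, q < D -> proc st' i (tl j) (hd j) q,
        forall u v q, u < n -> q < D -> proc st0 i u v q -> proc st' i u v q &
        T <= 2300 * W]).
Proof.
move=> C r12 r13 r15 jm I0.
have [un vn] := tlhd jm; have D0 := D_gt0.
have Euv : E (tl j) (hd j) by exists j.
set u := tl j in un Euv *; set v := hd j in vn Euv *.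
have sE k a : slot k 0 + D * a = slot k a.
  by rewrite /slot addn0 mulnDl mulnC [a * D]mulnC addnC; lia.
have YW : D * (D * D * (p + D + D)) <= W by rewrite leq_pmull.
have DY : D <= D * (D * D * (p + D + D)) by rewrite leq_pmulr // !muln_gt0; lia.
have [[c0 c1 c2 c3 c4 c5 c7 c8 c9 c11 ct ch cc] rest] := (C, I0).
do 2!seqset; apply/wp_seq/wp_conseq.
  exact: (@wp_AddMul 17 44 _ D (slot i 0) u).
move=> st1 T1 ag1 [r17 T1B]; rewrite sE in r17; fr ag1.
have I1 : inv st1 i by rewrite /inv !ag1.2 // ag1.1.
have P1 u' v' q : proc st0 i u' v' q -> proc st1 i u' v' q by rewrite /proc !ag1.2.
do 2!seqset; apply/wp_seq/wp_conseq.
  exact: (@wp_AddMul 19 18 _ D (slot i.+1 0) v).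
move=> st2 T2 ag2 [r19 T2B]; rewrite sE in r19.
have r18 : reg st2 18 = v by rewrite ag2.1.
have {}P1 u' v' q : proc st0 i u' v' q -> proc st2 i u' v' q.
  by move/P1; rewrite /proc !ag2.2.
fr ag2.
have {}I1 : inv st2 i by rewrite /inv !ag2.2 // ag2.1.
have C2 : ctx st2 by split.
apply: (@wp_for _ _ _ _ D (2100 * (D * (D * D * (p + D + D)))) (fun q' st' =>
  [/\ inv st' i, forall q, q < q' -> proc st' i u v q &
      forall u' v' q, u' < n -> q < D -> proc st0 i u' v' q -> proc st' i u' v' q])) => //=.
- by split=> // u' v' q _ _ /P1.
- move=> q st3 qD ag rq [J1 J2 J3].
  have C3 := ctx_agree ag isT isT C2.
  clear c0 c1 c2 c3 c4 c5 c7 c8 c9 c11 ct ch cc.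
  have [c0 c1 c2 c3 c4 c5 c7 c8 c9 c11 ct ch cc] := C3.
  fr ag; seqset; apply: wp_if => /= Fq; last first.
    apply: wp_skip; split; first by rewrite /=; clear -DY D0; lia.
    split=> //= q1; rewrite ltnS leq_eqVlt => /orP[/eqP->|]; last exact: J2.
    by rewrite /proc /processed /= => F1; rewrite Fq in F1.
  have [so ta _ _] := J1.
  have [_ [rs [w hw ho]]] := sound_entry so un qD Fq.
  apply: wp_conseq.
    apply: (@wp_Candidate _ n p r K D cl (arr st3 8) (arr st3 6) (arr st3 7)
      (slot i.+1 v) v t (reg st3 10) (slot i u + q) rs) => //=.
    - by move: np; lia.
    - by move=> k; apply: (walk_nth_le sn E_lt k w).
    - by move=> a; rewrite leq_eqVlt => /orP[/eqP->|/cl_lt/ltnW //]; rewrite cl_n.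
    - exact: ta.
  move=> st4 T4 ag4 [T4B res]; split; first by clear -T4B DY D0; lia.
  have [[fi [t4 cov [h hE ins]]]|[nfi [e8 e6 e7 e10]]] := res.
    have w' : walk n r K cl E s i.+1 (v :: rs) by apply: WalkS; rewrite ?hw.
    split.
    - exact: (invariant_inserted pp np rD KD RD r0K sn tn sNt E_lt cl_n ins J1 t4 w' hE).
    - move=> q1; rewrite ltnS leq_eqVlt => /orP[/eqP->|q1q].
        apply: (processed_intro (rs := rs)) => //.
        exact: holds_inserted ins ho.
      apply: (processed_inserted pp np rD KD RD r0K sn tn sNt cl_n un vn _ ins); last exact: J2.
      exact: ltn_trans qD.
    - move=> u' v' q1 un' q1D pr.
      by apply: (processed_inserted pp np rD KD RD r0K sn tn sNt cl_n un' vn q1D ins); apply: J3.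
  split; rewrite /inv /proc /= ?e8 ?e6 ?e7 ?e10 //.
  - move=> q1; rewrite ltnS leq_eqVlt => /orP[/eqP->|]; last exact: J2.
    by apply: (processed_intro (rs := rs)).
move=> st5 T5 ag5 _ [J1 J2 J3] T5B; split=> //.
move: T5B => /=; rewrite /W; move: YW DY; rewrite /W.
move: (D * (D * D * (p + D + D))) => Y YW DY; clear -T1B T2B DY D0 YW.
have : D <= D * Y by apply: leq_trans YW.
by nia.
Qed.

Lemma wp_Level st0 i : ctx st0 -> reg st0 12 = slot i 0 -> 0 < m ->
  inv st0 i ->
  wp Level st0 (fun st' T =>
    [/\ sound n r K D cl E s (arr st' 8) (arr st' 6) i.+1, inv st' i.+1,
        reg st' 12 = slot i.+1 0 & T <= 2400 * (m * W)]).
Proof.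
move=> C r12 m0 I0; have D0 := D_gt0.
have [[c0 c1 c2 c3 c4 c5 c7 c8 c9 c11 ct ch cc] rest] := (C, I0).
seqset; apply/wp_seq/wp_conseq.
  exact: (@wp_AddMul 13 0 _ D (slot i 0) n).
move=> st1 T1 ag1 [r13 T1B].
have {}r13 : reg st1 13 = slot i.+1 0 by rewrite r13 /slot mulSn; lia.
have C1 : ctx st1.
  by apply: (ctx_agree ag1) => //; split.
fr ag1.
have I1 : inv st1 i by rewrite /inv !ag1.2 // ag1.1.
have DW : D <= W by rewrite /W leq_pmulr // !muln_gt0; lia.
apply: wp_seq; apply: (@wp_for _ _ _ _ m (2300 * W) (fun j st' =>
  inv st' i /\ forall j', j' < j -> forall q, q < D -> proc st' i (tl j') (hd j') q)) => //=.
- move=> j st2 jm ag rj [J1 J2]; have C2 := ctx_agree ag isT isT C1.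
  have [r12' r13'] : reg st2 12 = slot i 0 /\ reg st2 13 = slot i.+1 0.
    by rewrite !ag.1.
  apply: wp_conseq; first exact: (wp_ArcStep C2 r12' r13' rj jm J1).
  move=> st3 T3 ag3 [K1 K2 K3 T3B]; split=> //; split=> // j'.
  rewrite ltnS leq_eqVlt => /orP[/eqP->|jj]; first by move=> q qD; apply: K2.
  move=> q qD; apply: K3 => //; last exact: J2.
  by case: (tlhd (ltn_trans jj jm)).
move=> st2 T2 ag2 _ [J1 J2] T2B; apply: wp_set.
have [|so nx] := @invariant_next p n r K D cl E s t l pp np rD KD RD r0K
  sn tn sNt E_lt cl_lt cl_n rigid _ _ _ _ _ J1.
  by move=> u v q [j jm [<- <-]]; apply: J2.
split=> //=; first by rewrite ag2.1.
move: T2B => /=; have : D <= m * W by apply: leq_trans DW _; rewrite leq_pmull.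
have : m <= m * W by rewrite leq_pmulr //; lia.
by clear -T1B D0; lia.
Qed.

Lemma wp_Search st0 : ctx st0 -> 0 < m ->
  (forall f, arr st0 8 f = 0) ->
  wp Search st0 (fun st' T =>
    [/\ reg st' 10 = 1 \/ reg st' 10 = 0,
        reg st' 10 = 1 <->
          exists i rs, [/\ i <= l, walk n r K cl E s i rs & nth n rs 0 = t] &
        T <= 3000 * (maxn 1 l * (m * W))]).
Proof.
move=> C m0 F0; have D0 := D_gt0.
have [[c0 c1 c2 c3 c4 c5 c7 c8 c9 c11 ct ch cc] rest] := (C, F0).
seqset; apply/wp_seq/wp_conseq; first exact: (@wp_AddMul 43 2 _ D 0 s).
move=> st1 T1 ag1 [r43 T1B].
have {}F0 f : arr st1 8 f = 0 by rewrite ag1.2 //= F0.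
fr ag1; seqset; apply/wp_seq/wp_conseq.
  exact: (@wp_AddMul 35 43 _ D 0 (0 + D * s)).
move=> st2 T2 ag2 [r35 T2B].
have {}r43 : reg st2 43 = slot 0 s by rewrite ag2.1 //= r43 /slot mulnC.
have {}r35 : reg st2 35 = slot 0 s * D by rewrite r35 /slot; lia.
have {}F0 f : arr st2 8 f = 0 by rewrite ag2.2 //= F0.
fr ag2; apply: wp_seq; apply: (@wp_for _ _ _ _ D 10 (fun j st' =>
  forall k, k < j -> arr st' 6 (slot 0 s * D + k) = n)) => //=.
  move=> j st3 jD ag rj I; have r0 : reg st3 0 = n by rewrite ag.1.
  have r35' : reg st3 35 = slot 0 s * D by rewrite ag.1.
  apply: wp_arr; split=> //= k; rw; rewrite ltnS eqn_add2l leq_eqVlt.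
  by case: (k =P j) => //= _; apply: I.
move=> st3 T3 ag3 _ I3 T3B.
have {}F0 f : arr st3 8 f = 0 by rewrite ag3.2 //= F0.
fr ag3; apply/wp_seq/wp_arr => /=; apply/wp_seq/wp_arr => /=; do 2!seqset.
set st4 := (X in wp _ X _).
have C4 : ctx st4 by split.
have [||so0 I0] := @invariant_init p n r K D cl E s t l pp np rD KD RD r0K sn tn sNt cl_n
    (arr st4 8) (arr st4 6) (arr st4 7).
- by move=> f; rewrite /st4 /= F0; case: eqP.
- move=> k kD; rewrite /hist /st4 /= -{2}[slot 0 s * D]addn0 eqn_add2l.
  by case: k kD => [|k] kD //=; rewrite nth_nil I3.
apply: (@wp_for _ _ _ _ l (2400 * (m * W)) (fun i st' =>
  [/\ sound n r K D cl E s (arr st' 8) (arr st' 6) i, inv st' i & reg st' 12 = slot i 0])) => //.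
- move=> i st5 il ag ri [J1 J2 J3]; have C5 := ctx_agree ag isT isT C4.
  apply: wp_conseq; first exact: (wp_Level C5 J3 m0 J2).
  by move=> st6 T6 ag6 [K1 K2 K3 T6B].
move=> st5 T5 ag5 _ [J1 J2 J3] T5B.
have [c01 cE] := invariant_final tn sNt J1 J2.
split=> //; move: T5B => /=.
have [Z ZE] : exists Z, Z = maxn 1 l * (m * W) by eexists.
have lZ : l * (m * W) <= Z by rewrite ZE leq_mul2r leq_maxr orbT.
have mW : m * W <= Z by rewrite ZE leq_pmull // leq_maxl.
have DW : D <= W by rewrite /W leq_pmulr // !muln_gt0; lia.
have DZ : D <= Z by apply: leq_trans mW; apply: leq_trans DW _; rewrite leq_pmull.
have W0 : 0 < m * W by rewrite muln_gt0 m0; lia.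
have lz : l <= l * (m * W) by rewrite leq_pmulr.
rewrite -ZE; move: (m * W) lz lZ => Y lz lZ; clear -T1B T2B T3B lz lZ DZ D0.
by rewrite /= in T3B; lia.
Qed.
End SearchRun.

(** * Preprocessing *)

Definition Bfs : program :=
  SetArr 3 (Reg 2) (Const 1) ;;
  For 45 (Reg 0) (
    For 46 (Reg 1) (
      If (Neq (Get 3 (Get 0 (Reg 46))) (Add (Reg 45) (Const 1))) Skip
        (If (Get 3 (Get 1 (Reg 46))) Skip
          (SetArr 3 (Get 1 (Reg 46)) (Add (Reg 45) (Const 2)))))).

Fixpoint reach (E : nat -> nat -> Prop) (s k v : nat) : Prop :=
  if k is k'.+1 then exists2 u, reach E s k' u & E u v else v = s.

Lemma wp_Bfs st n m s tl hd :
  let E u v := exists2 j, j < m & tl j = u /\ hd j = v in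
  0 < n -> 0 < m ->
  reg st 0 = n -> reg st 1 = m -> reg st 2 = s -> arr st 0 = tl ->
  arr st 1 = hd -> (forall v, arr st 3 v = 0) ->
  wp Bfs st (fun st' T =>
    [/\ forall v k, arr st' 3 v = k.+1 -> reach E s k v,
        forall v k, k <= n -> reach E s k v -> 0 < arr st' 3 v <= k.+1,
        forall v, arr st' 3 v <= n.+1 &
        T <= 100 * (n * m)]).
Proof.
move=> E n0 m0 r0 r1 r2 a0 a1 a3; apply/wp_seq/wp_arr => /=; rw.
apply: (@wp_for _ _ _ _ n (60 * m) (fun i st' =>
  [/\ forall v k, arr st' 3 v = k.+1 -> reach E s k v,
      forall v k, k <= i -> reach E s k v -> 0 < arr st' 3 v <= k.+1 &
      forall v, arr st' 3 v <= i.+1])) => //=.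
- split=> [v k|v k|v].
  + by case: eqP => [-> [<-] //|_]; rewrite a3.
  + by rewrite leqn0 => /eqP -> ->; rewrite eqxx.
  + by case: eqP => _; rewrite ?a3.
- move=> i st1 iN ag ri [S Ci Bi].
  (* Heads reached in this round get the label i + 2, so they do not act as tails in the same round.
     The last clause says that the scanned arcs leave no head of a level i tail unlabelled. *)
  apply: (@wp_for _ _ _ _ m 35 (fun j st' =>
    [/\ forall v k, arr st' 3 v = k.+1 -> reach E s k v,
        forall v k, k <= i -> reach E s k v -> 0 < arr st' 3 v <= k.+1,
        forall v, arr st' 3 v <= i.+2 &
        forall j', j' < j -> arr st' 3 (tl j') = i.+1 -> 0 < arr st' 3 (hd j')])) => //=.
  + by rewrite ag.1.
  + by split=> // v; apply: leqW.
  + move=> j st2 jm ag2 rj [S2 C2 B2 A2].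
    have [c0 c1 ri'] : [/\ arr st2 0 = tl, arr st2 1 = hd & reg st2 45 = i].
      by split; [rewrite ag2.2 // ag.2|rewrite ag2.2 // ag.2|rewrite ag2.1].
    have sA L : (L (tl j) = i.+1 -> 0 < L (hd j)) ->
        (forall j', j' < j -> L (tl j') = i.+1 -> 0 < L (hd j')) ->
        forall j', j' < j.+1 -> L (tl j') = i.+1 -> 0 < L (hd j').
      by move=> Lj Ll j'; rewrite ltnS leq_eqVlt => /orP[/eqP->|/Ll].
    apply: wp_if => [e|/Neq_eq0 e].
      apply: wp_skip; split=> //; split=> //; apply: sA A2 => /= ej.
      by move/eqP: e; case; apply/Neq_eq0; rewrite /= rj c0 ri' addn1.
    rewrite /= rj c0 ri' addn1 in e.
    apply: wp_if => /=; rw => e2.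
      by apply: wp_skip; split=> //; split=> //; apply: sA A2 => _; rewrite lt0n.
    apply: wp_arr; split=> //=; rw; split.
    * move=> v k; case: eqP => [->|_]; last exact: S2.
      rewrite addn2 => -[<-] /=; exists (tl j); first exact: S2.
      by exists j.
    * move=> v k ki rk; case: eqP => [ev|_]; last exact: C2.
      by have := C2 v k ki rk; rewrite ev e2.
    * by move=> v; case: eqP => _; rewrite ?addn2.
    * apply: (sA (fun x => if x == hd j then i + 2 else arr st2 3 x)).
        by rewrite eqxx addn2.
      move=> j' jj; case: eqP => [_|_ /(A2 _ jj)]; first by lia.
      by case: eqP => //; lia.
  move=> st2 T2 ag2 _ [S2 C2 B2 A2] T2B; split; first by move: T2B => /=; lia.
  split=> //= v k; rewrite leq_eqVlt => /orP[/eqP->|/C2]; last by apply.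
  move=> [u ru [j jm [ju jv]]].
  have /andP[u0 ui] := C2 u i (leqnn i) ru.
  have := B2 v; have := A2 j jm; rewrite ju jv.
  have [-> /(_ erefl)|ne _ _] := eqVneq (arr st2 3 u) i.+1.
    by move=> -> ->.
  have ek : arr st2 3 u = (arr st2 3 u).-1.+1 by rewrite prednK.
  have := C2 v (arr st2 3 u).-1.+1 _ _; rewrite -ek.
  have lt : arr st2 3 u <= i by rewrite -ltnS ltn_neqAle ne.
  move=> /(_ lt) H; have /H/andP[-> h2] : reach E s (arr st2 3 u) v.
    by rewrite ek; exists u; [apply: S2|exists j].
  by apply: leq_trans h2 _; apply: leqW.
move=> st1 T1 ag1 _ [S1 C1 B1] T1B; split=> //.
move: T1B => /=; have := leq_mul n0 m0; nia.
Qed.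

(** Register 47 holds 16 n^2 = (4n)^2, so a composite number up to it has a proper divisor at most
    4n. Crossing out multiples of 2, ..., 4n + 1 therefore suffices and keeps the time cubic. *)
Definition Sieve : program :=
  47 ::= Const 0 ;;
  For 45 (Reg 0) (47 ::= Add (Reg 47) (Reg 0)) ;;
  47 ::= Add (Reg 47) (Reg 47) ;;
  47 ::= Add (Reg 47) (Reg 47) ;;
  47 ::= Add (Reg 47) (Reg 47) ;;
  47 ::= Add (Reg 47) (Reg 47) ;;
  48 ::= Add (Add (Reg 0) (Reg 0)) (Add (Reg 0) (Reg 0)) ;;
  For 45 (Reg 48) (
    49 ::= Add (Reg 45) (Const 2) ;;
    50 ::= Reg 49 ;;
    For 46 (Reg 47) (
      50 ::= Add (Reg 50) (Reg 49) ;;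
      SetArr 4 (Reg 50) (Const 1))) ;;
  9 ::= Add (Reg 0) (Const 2) ;;
  For 45 (Reg 47) (
    If (Get 4 (Reg 9)) (9 ::= Add (Reg 9) (Const 1)) Skip).

Lemma prime_sieve n q : 1 < q -> q <= 16 * (n * n) ->
  (forall d i, d < 4 * n -> i < 16 * (n * n) -> q <> d.+2 * i.+2) -> prime q.
Proof.
move=> q1 qB no; apply/primeP; split=> // d /dvdnP[k e].
have [d1|d1] := eqVneq d 1; first by [].
have [_|dq] := eqVneq d q; first by rewrite orbT.
have k0 : k != 0 by apply: contraTneq q1 => k0; rewrite e k0.
have k1 : k != 1 by apply: contraNneq dq => k1; rewrite e k1 mul1n.
have d0 : d != 0 by apply: contraTneq q1 => d0; rewrite e d0 muln0.
wlog dk : d k e d1 dq k0 k1 d0 / d <= k.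
  case: (leqP d k) => dk H; first exact: (H d k).
  apply: (H k d) => //; rewrite 1?mulnC //; last exact: ltnW.
  by rewrite e; apply: contra d1 => /eqP; nia.
exfalso; case: (no d.-2 k.-2); [nia|nia|].
by rewrite e mulnC; congr (_ * _); lia.
Qed.

Lemma wp_Sieve st n : 1 < n -> reg st 0 = n -> (forall q, arr st 4 q = 0) ->
  wp Sieve st (fun st' T =>
    [/\ prime (reg st' 9), n.+1 < reg st' 9, reg st' 9 <= 16 * (n * n) &
        T <= 3000 * (n * (n * n))]).
Proof.
move=> n1 r0 a4; seqset; apply: wp_seq.
apply: (@wp_for _ _ _ _ n 4 (fun j st' => reg st' 47 = j * n)) => //=.
  move=> j st1 jn ag rj I; have r0' : reg st1 0 = n by rewrite ag.1.
  by apply: wp_set; split=> //=; rw; rewrite mulSn addnC.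
move=> st1 T1 ag1 _ r47 T1B; have {}a4 q : arr st1 4 q = 0 by rewrite ag1.2 //= a4.
fr ag1; do 5!seqset; set B := 16 * (n * n).
have -> : n * n + n * n + (n * n + n * n) + (n * n + n * n + (n * n + n * n)) +
  (n * n + n * n + (n * n + n * n) + (n * n + n * n + (n * n + n * n))) = B by rewrite /B; lia.
have -> : n + n + (n + n) = 4 * n by lia.
have [nB B0] : n <= B /\ 0 < B by rewrite /B; nia.
apply: wp_seq; apply: (@wp_for _ _ _ _ (4 * n) (30 * B) (fun d st' =>
  forall q, arr st' 4 q != 0 <-> exists d' i, [/\ d' < d, i < B & q = d'.+2 * i.+2])) => //=.
- by move=> q; rewrite a4; split=> // -[d' [i []]].
- move=> d st2 dn ag2 rd I; do 2!seqset.
  apply: (@wp_for _ _ _ _ B 8 (fun i st' => reg st' 50 = d.+2 * i.+1 /\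
    forall q, arr st' 4 q != 0 <->
      (arr st2 4 q != 0 \/ exists2 i', i' < i & q = d.+2 * i'.+2))) => //=.
  + by rewrite ag2.1.
  + split=> [|q]; first by rewrite addn2 muln1.
    by split=> [|[]//]; [left|case].
  + move=> i st3 iB ag3 ri [I1 I2].
    have r49 : reg st3 49 = d.+2 by rewrite ag3.1 //= addn2.
    seqset; apply: wp_arr; split=> //=; rw; split=> [|q]; first by rewrite [in RHS]mulnS addnC.
    case: (q =P d.+2 * i.+1 + d.+2) => [->|nq].
      split=> // _; right; exists i => //; rewrite [in RHS]mulnS; lia.
    rewrite I2; split=> -[h|[i' h e]]; [by left| |by left|].
      by right; exists i' => //; apply: ltnW.
    right; exists i' => //; move: h; rewrite ltnS leq_eqVlt => /orP[/eqP ei|//].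
    by case: nq; rewrite e ei [in LHS]mulnS; lia.
  move=> st3 T3 ag3 _ [I1 I2] T3B; split; first by move: T3B => /=; lia.
  move=> q; rewrite /= I2 I; split.
    move=> [[d' [i [h1 h2 h3]]]|[i iB e]]; first by exists d', i; split=> //; apply: ltnW.
    by exists d, i.
  move=> [d' [i [h1 h2 h3]]]; move: h1; rewrite ltnS leq_eqVlt => /orP[/eqP ed|h1].
    by right; exists i; rewrite -?ed.
  by left; exists d', i.
move=> st2 T2 ag2 _ I T2B.
have r47' : reg st2 47 = B by rewrite ag2.1.
have r0' : reg st2 0 = n by rewrite ag2.1.
have [q0 [q0p nq0 q0B]] := prime_window n1.
have comp0 : arr st2 4 q0 = 0.
  apply/eqP; apply: contraT => /I[d [i [_ _ e]]].
  move: q0p => /primeP[_ /(_ d.+2)]; rewrite e dvdn_mulr // => /(_ isT).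
  by case/orP=> /eqP; nia.
have q0B' : q0 <= B by rewrite /B; move: q0B; rewrite mulnn.
seqset; rewrite addn2.
apply: (@wp_for _ _ _ _ B 20 (fun j st' =>
  [/\ n.+1 < reg st' 9, reg st' 9 <= q0 &
      reg st' 9 = n.+2 + j \/ arr st2 4 (reg st' 9) = 0])) => //=.
- by split=> //; left; rewrite addn0.
- move=> j st3 jB ag3 rj [I1 I2 I3]; have a4' : arr st3 4 = arr st2 4 by rewrite ag3.2.
  apply: wp_if; rewrite /= a4' => e; last first.
    by apply: wp_skip; split=> //; split=> //=; right.
  apply: wp_set; split=> //=; rewrite addn1; split.
  + exact: ltnW.
  + rewrite ltn_neqAle I2 andbT; apply: contra e => /eqP ->; exact/eqP.
  + by left; case: I3 => [->|e0]; [rewrite addnS|rewrite e0 in e].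
move=> st3 T3 ag3 _ [I1 I2 I3] T3B.
(* The other alternative would put register 9 at n + 2 + 16 n^2, beyond the prime [q0]. *)
have c0 : arr st2 4 (reg st3 9) = 0 by case: I3 => // e; lia.
split=> //; last first.
- move: T1B T2B T3B => /=; rewrite {1}/B; move: n1; rewrite /B.
  have -> : 4 * n * (30 * (16 * (n * n)) + 1 + 7) =
    1920 * (n * (n * n)) + 32 * n by lia.
  by clear; nia.
- by apply: leq_trans I2 q0B'.
apply: (@prime_sieve n); [by lia|exact: leq_trans I2 q0B'|].
move=> d i dn iB e; suff : arr st2 4 (reg st3 9) != 0 by rewrite c0.
by apply/I; exists d, i.
Qed.

(** Given colors are arbitrary numbers and might coincide modulo p; the largest vertex of the same
    color is a name below n. *)
Fixpoint last_index (C : nat -> nat) (v j : nat) : nat :=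
  if j is j'.+1 then
    if C v == C j' then j' else last_index C v j'
  else 0.

Lemma last_indexP C v j : v < j ->
  last_index C v j < j /\ C (last_index C v j) = C v.
Proof.
elim: j => //= j IH; rewrite ltnS leq_eqVlt.
have [e _|ne] := eqVneq (C v) (C j); first by split.
case/orP=> [/eqP e|/IH[lt ->]]; first by rewrite e eqxx in ne.
by split=> //; apply: ltnW.
Qed.

Lemma last_index_ext C u v j : C u = C v -> last_index C u j = last_index C v j.
Proof. by move=> e; elim: j => //= j ->; rewrite e. Qed.

Definition Colors : program :=
  For 45 (Reg 0) (
    For 46 (Reg 0) (
      If (Neq (Get 2 (Reg 45)) (Get 2 (Reg 46))) Skip
        (SetArr 5 (Reg 45) (Reg 46)))) ;;
  SetArr 5 (Reg 0) (Reg 0).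

Lemma wp_Colors st n C : 0 < n -> reg st 0 = n -> arr st 2 = C ->
  (forall v, arr st 5 v = 0) ->
  wp Colors st (fun st' T =>
    [/\ forall v, v < n -> arr st' 5 v = last_index C v n,
        arr st' 5 n = n & T <= 100 * (n * n)]).
Proof.
move=> n0 r0 a2 a5; apply: wp_seq.
apply: (@wp_for _ _ _ _ n (40 * n) (fun i st' =>
  forall v, arr st' 5 v = if v < i then last_index C v n else 0)) => //=.
- move=> i st1 iN ag ri I; have [r01 a21] : reg st1 0 = n /\ arr st1 2 = C.
    by rewrite ag.1 // ag.2.
  apply: (@wp_for _ _ _ _ n 20 (fun j st' =>
    forall v, arr st' 5 v = if v < i then last_index C v n
                            else if v == i then last_index C i j else 0)) => //=.
  + by move=> v; rewrite I; case: ifP => // _; case: ifP.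
  + move=> j st2 jn ag2 rj J.
    have [ri' a22] : reg st2 45 = i /\ arr st2 2 = C by rewrite ag2.1 // ag2.2.
    apply: wp_if => [e|/Neq_eq0 e].
      apply: wp_skip; split=> // v; rewrite J; case: ifP => //= _; case: ifP => // _.
      case: eqP => // e2; case/eqP: e; apply/Neq_eq0.
      by rewrite /= ri' a22 rj.
    apply: wp_arr; split=> //= v; rw; rewrite J.
    rewrite /= ri' a22 rj in e; rewrite e eqxx.
    by case: (v =P i) => [->|]; rewrite ?ltnn.
  move=> st2 T2 ag2 _ J T2B; split; first by move: T2B => /=; nia.
  move=> v; rewrite /= J ltnS [v <= i]leq_eqVlt.
  by have [->|_] := eqVneq v i; rewrite ?ltnn //=; case: ifP.
move=> st1 T1 ag1 _ I T1B; have r01 : reg st1 0 = n by rewrite ag1.1.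
apply: wp_arr; rewrite /= r01; split; rewrite ?eqxx //.
  by move=> v vn; rewrite I vn ltn_eqF.
by move: T1B => /=; nia.
Qed.

(** The summands r and K + 1 make D exceed r and K, so that D cells hold every history entry that
    the tests inspect. *)
Definition Setup : program :=
  11 ::= Add (Reg 4) (Const 1) ;;
  If (Sub (Reg 4) (Const 1)) (7 ::= Sub (Reg 5) (Reg 6)) (7 ::= Const 0) ;;
  8 ::= Const 1 ;;
  For 45 (Add (Reg 4) (Add (Reg 7) (Reg 7))) (
    50 ::= Const 0 ;;
    For 46 (Reg 11) (50 ::= Add (Reg 50) (Reg 8)) ;;
    8 ::= Reg 50) ;;
  8 ::= Add (Add (Reg 8) (Reg 4)) (Add (Reg 7) (Const 1)).

Lemma wp_Setup st r l d : reg st 4 = r -> reg st 5 = l -> reg st 6 = d ->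
  let K := if 1 < r then l - d else 0 in
  let D := r.+1 ^ (r + (K + K)) + r + K.+1 in
  wp Setup st (fun st' T =>
    [/\ reg st' 11 = r.+1, reg st' 7 = K, reg st' 8 = D & T <= 200 * (D * D)]).
Proof.
move=> r4 r5 r6 K D; seqset; rewrite addn1; apply: wp_seq.
apply: (@wp_conseq _ _ (fun st' T => reg st' 7 = K /\ T <= 10)).
  apply: wp_if => /=; rw => h; apply: wp_set => /=; rw; rewrite /K.
    by rewrite (_ : 1 < r = true) //; lia.
  by rewrite (_ : 1 < r = false) //; lia.
move=> st1 T1 ag1 [r7 T1B]; have [r11 r4'] : reg st1 11 = r.+1 /\ reg st1 4 = r.
  by rewrite !ag1.1.
seqset; apply: wp_seq.
apply: (@wp_for _ _ _ _ (r + (K + K)) (20 * r.+2)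
  (fun j st' => reg st' 8 = r.+1 ^ j)) => //=; rw => //.
- move=> j st2 jK ag2 rj I; have r11' : reg st2 11 = r.+1 by rewrite ag2.1.
  seqset; apply: wp_seq.
  apply: (@wp_for _ _ _ _ r.+1 4 (fun i st' => reg st' 50 = i * r.+1 ^ j)) => //=.
    move=> i st3 ir ag3 ri J; have r8' : reg st3 8 = r.+1 ^ j by rewrite ag3.1.
    by apply: wp_set; split=> //=; rw; rewrite mulSn addnC.
  move=> st3 T3 ag3 _ J T3B; apply: wp_set; split; first by move: T3B => /=; lia.
  by rewrite /= J expnS.
move=> st2 T2 ag2 _ I T2B; apply: wp_set => /=.
have [r11' r7' r4''] : [/\ reg st2 11 = r.+1, reg st2 7 = K & reg st2 4 = r].
  by rewrite !ag2.1.
rw; rewrite addn1; split=> //.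
have D1 : r.+1 + K <= D by rewrite /D; lia.
have m1 : (r + (K + K)) * (20 * r.+2 + 13) <= (D + D) * (53 * D).
  by apply: leq_mul; lia.
rewrite /= in T2B; clear -T1B T2B D1 m1; nia.
Qed.

(** * Paths and walks *)

Section Graph.
Variables (G : digraph) (c : 'I_(nvert G) -> nat) (s t : 'I_(nvert G)).
Local Notation V := 'I_(nvert G).
Local Notation n := (nvert G).
Implicit Types (p : seq V) (x y : V).

(** The window conditions by pairs of positions. Unlike [rainbow], this also constrains sequences
    shorter than a window. *)
Definition spaced (r K : nat) (vs : seq V) : Prop :=
  forall a b, a < b < size vs ->
    (b - a <= r -> c (nth s vs a) <> c (nth s vs b)) /\
    (b - a <= K -> nth s vs a <> nth s vs b).

Lemma last_take_nth x p a : a <= size p -> last x (take a p) = nth x (x :: p) a.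
Proof. by elim: p x a => [|y p IH] x [|a] //= ap; rewrite IH //; apply: set_nth_default. Qed.

Lemma path_shortcut x p a b : path (@arrow G) x p -> a <= b <= size p ->
  nth x (x :: p) a = nth x (x :: p) b ->
  exists p', [/\ path (@arrow G) x p', last x p' = last x p &
                 size p' + (b - a) = size p].
Proof.
move=> xp /andP[ab bp] e; have ap := leq_trans ab bp.
exists (take a p ++ drop b p); split.
- have := xp; rewrite -{1}(cat_take_drop b p) cat_path => /andP[_ db].
  rewrite cat_path last_take_nth // e -last_take_nth // db andbT.
  by have := xp; rewrite -{1}(cat_take_drop a p) cat_path => /andP[].
- by rewrite last_cat last_take_nth // e -last_take_nth // -last_cat cat_take_drop.
- by rewrite size_cat size_takel // size_drop; lia.
Qed.

Lemma shorten_dipath p : path (@arrow G) s p -> last s p = t ->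
  exists2 p', dipath s t p' & size p' <= size p.
Proof.
move=> sp lt; have := erefl (last s p); rewrite {1}lt.
case/shortenP: sp => p' sp' up' sub lp'; exists p'.
  by rewrite /dipath sp' -lp' eqxx.
by apply: uniq_leq_size sub; case/andP: up'.
Qed.

Lemma dipath_size p : dipath s t p -> size p < n.
Proof.
case/and3P=> _ _ /card_uniqP /= e; have := max_card (mem (s :: p)).
by rewrite e card_ord.
Qed.

Lemma detour_ge d l p : path (@arrow G) s p -> last s p = t -> size p <= d ->
  l - d <= detour s t l.
Proof.
move=> sp lt pd; have [p' dp' p'p] := shorten_dipath sp lt.
have hp' : has_dipath s t (size p').
  by apply/existsP; exists (in_tuple p').
have ex : exists q, has_dipath s t q by exists (size p').
rewrite /detour /dist; case: pickP => [e /andP[_ /forallP/(_ (Ordinal (dipath_size dp')))]|no].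
  by rewrite hp' /=; lia.
(* The distance cannot be infinite: the least length of an s-t path is below n, within the range of
   [pick]. *)
case: (ex_minnP ex) => q hq qmin.
have qn : q < n by apply: leq_ltn_trans (qmin _ hp') (dipath_size dp').
have := no (Ordinal qn); rewrite /= hq => /negbT/forallPn[e].
by rewrite negb_imply => /andP[/qmin ->].
Qed.

Lemma rainbow_pairs r (vs : seq V) :
  (forall a b, a < b < size vs -> b - a <= r -> c (nth s vs a) <> c (nth s vs b)) ->
  rainbow c r vs.
Proof.
move=> H i ir; apply/negPn/negP => /(uniqPn 0)[a [b [ab]]].
rewrite size_map => bs.
have br : b <= r by move: bs; rewrite size_take; case: ifP; lia.
have e k : k <= r -> nth 0 [seq c x | x <- take r.+1 (drop i vs)] k = c (nth s vs (i + k)).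
  move=> kr; rewrite (nth_map s) ?nth_take ?nth_drop //.
  by rewrite size_takel ?size_drop; lia.
by rewrite !e //; [apply: H; lia|lia].
Qed.

Lemma rainbow_spaced r K p : dipath s t p -> rainbow c r (s :: p) -> r <= size p ->
  spaced r K (s :: p).
Proof.
move=> /and3P[_ _ un] rb rp a b /andP[ab bp].
have ne (i j : nat) : i < size (s :: p) -> j < size (s :: p) -> i < j ->
    nth s (s :: p) i <> nth s (s :: p) j.
  by move=> ip jp ij /eqP; rewrite nth_uniq // => /eqP e; rewrite e ltnn in ij.
split=> [bar|_]; last by apply: ne => //; apply: ltn_trans bp.
(* The start of a full window containing both positions, moved left if a is too close to the end; it
   exists because [r <= size p]. *)
pose i := minn a (size p - r).
have [ia ib] : i <= a /\ b <= i + r by move: bp => /=; rewrite /i; lia.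
have ir : i + r < size (s :: p) by rewrite /= /i; lia.
have e k : i <= k <= i + r -> c (nth s (s :: p) k) =
    nth 0 [seq c x | x <- take r.+1 (drop i (s :: p))] (k - i).
  move=> /andP[ik kr]; rewrite (nth_map s) ?nth_take ?nth_drop ?subnKC //; first by lia.
  by rewrite size_takel ?size_drop; lia.
rewrite !e; try lia; move=> /eqP; rewrite nth_uniq ?(rb i ir) //.
- by move/eqP; lia.
- by rewrite size_map size_takel ?size_drop; lia.
- by rewrite size_map size_takel ?size_drop; lia.
Qed.

(** Cutting out the part between two equal vertices leaves at least d arcs, so they are at most l -
    d <= K steps apart, where [spaced] forbids equality. *)
Lemma spaced_uniq r K l d p : (forall p, path (@arrow G) s p -> last s p = t -> d <= size p) ->
  path (@arrow G) s p -> last s p = t -> size p <= l -> l - d <= K ->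
  spaced r K (s :: p) -> uniq (s :: p).
Proof.
move=> dmin sp lt pl Kl sd; apply/negPn/negP => /(uniqPn s)[a [b [ab bp e]]].
have [|p' [sp' lp' sz]] := path_shortcut (a := a) (b := b) sp _ e.
  by rewrite ltnW.
have := dmin p' sp'; rewrite lp' => /(_ lt) dp'.
by have [|_] := sd a b; [rewrite ab|move/(_ _)/(_ e); apply; lia].
Qed.

Lemma spaced_rainbow r K p : spaced r K (s :: p) -> rainbow c r (s :: p).
Proof. by move=> sd; apply: rainbow_pairs => a b /sd[]. Qed.

(* For r <= 1 the rainbow condition only concerns consecutive vertices, so it
   survives the removal of cycles. *)
Lemma spaced_shorten r K p : r <= 1 -> path (@arrow G) s p -> last s p = t ->
  spaced r K (s :: p) ->
  exists p', [/\ dipath s t p', rainbow c r (s :: p') & size p' <= size p].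
Proof.
move=> r1 sp lt sd.
pose e x y := arrow x y && ((r == 1) ==> (c x != c y)).
have ep : path e s p.
  apply/(pathP s) => i ip; rewrite /e (pathP s sp i ip) /=.
  apply/implyP => /eqP er; apply/eqP.
  by have [|h _] := sd i i.+1; [rewrite ltnS leqnn|apply: h; rewrite er subSnn].
have := erefl (last s p); rewrite {1}lt.
case/shortenP: ep => p' ep' up' sub lp'; exists p'; split.
- rewrite /dipath -lp' eqxx up' andbT andbT.
  by apply: sub_path ep' => x y /andP[].
- apply: rainbow_pairs => a b /andP[ab bp] bar.
  have eb : b = a.+1 by lia.
  have er : r == 1 by lia.
  have := pathP s ep' a; rewrite eb /= in bp *; move=> /(_ bp) /andP[_].
  by rewrite er => /eqP.
- by apply: uniq_leq_size sub; case/andP: up'.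
Qed.

Variables (r K : nat) (cl : nat -> nat) (E : nat -> nat -> Prop).
Hypothesis EV : forall u v, E u v <->
  exists x y : V, [/\ arrow x y, val x = u & val y = v].
Hypothesis clE : forall x y, cl (val x) = cl (val y) <-> c x = c y.
Hypothesis cl_lt : forall x, cl (val x) < n.
Hypothesis cl_n : cl n = n.
Local Notation walk := (walk n r K cl E (val s)).
Local Notation track p := (rev [seq val x | x <- s :: p]).

Lemma nth_track p k : k <= size p -> nth n (track p) k = val (nth s (s :: p) (size p - k)).
Proof.
move=> kp; rewrite nth_rev size_map ?ltnS // subSS (nth_map s) //.
by rewrite /= ltnS leq_subr.
Qed.

Lemma track_rcons p y : track (rcons p y) = val y :: track p.
Proof. by rewrite -rcons_cons map_rcons rev_rcons. Qed.

(** Beyond the start of the walk the history shows the dummy n, whose color n no vertex has, so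
    [fits] imposes nothing there. *)
Lemma spaced_rcons p y : spaced r K (s :: rcons p y) <->
  spaced r K (s :: p) /\ fits r K cl (nth n (track p)) (val y).
Proof.
have e a : a <= size p -> nth s (s :: rcons p y) a = nth s (s :: p) a.
  by move=> ap; rewrite -rcons_cons nth_rcons /= ltnS ap.
have ey : nth s (s :: rcons p y) (size p).+1 = y.
  by rewrite -rcons_cons nth_rcons /= ltnn eqxx.
split=> [sd|[sd [f1 f2]]].
  split.
    move=> a b /andP[ab bp]; have := sd a b; rewrite !e; try by move: bp => /=; lia.
    by apply; rewrite ab /= size_rcons ltnW.
  have H k : k <= size p -> [/\ k < r -> c (nth s (s :: p) (size p - k)) <> c y &
      k < K -> nth s (s :: p) (size p - k) <> y].
    move=> kp; have [|h1 h2] := sd (size p - k) (size p).+1.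
      by rewrite /= size_rcons; lia.
    rewrite ey e ?leq_subr // in h1 h2.
    by split=> kr; [apply: h1|apply: h2]; lia.
  split=> k kr; have [kp|kp] := leqP k (size p).
  + by rewrite nth_track // => /clE /esym; apply: (H k kp).1.
  + rewrite nth_default ?size_rev ?size_map // cl_n => e0.
    by have := cl_lt y; rewrite e0 ltnn.
  + by rewrite nth_track // => /val_inj /esym; apply: (H k kp).2.
  + rewrite nth_default ?size_rev ?size_map // => e0.
    by have := ltn_ord y; rewrite /= -[X in X < _]/(val y) e0 ltnn.
move=> a b /andP[ab]; rewrite /= size_rcons ltnS leq_eqVlt => /orP[/eqP eb|bp].
  have ap : a <= size p by lia.
  rewrite eb ey e //; have k0 : size p - (size p - a) = a by lia.
  split=> h.
    have := f1 (size p - a); rewrite nth_track ?leq_subr // k0 => H /esym/clE.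
    by apply: H; lia.
  have := f2 (size p - a); rewrite nth_track ?leq_subr // k0 => H /esym ey'.
  by apply: H; [lia|rewrite ey'].
by rewrite !e; try lia; apply: sd; rewrite ab.
Qed.

Lemma path_walk p : path (@arrow G) s p -> spaced r K (s :: p) ->
  walk (size p) (track p).
Proof.
elim/last_ind: p => [|p y IH]; first by move=> _ _; apply: Walk0.
rewrite rcons_path size_rcons track_rcons => /andP[sp ay] /spaced_rcons[sd fi].
apply: WalkS => //; first exact: IH.
apply/EV; exists (last s p), y; split=> //.
by rewrite nth_track // subn0 nth_last.
Qed.

Lemma walk_path i rs : walk i rs -> exists p,
  [/\ path (@arrow G) s p, size p = i, rs = track p & spaced r K (s :: p)].
Proof.
elim=> [|{}i v {}rs _ [p [sp <- -> sd]] /EV[x [y [ax ex <-]]] fi].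
  by exists [::]; split=> // a b /=; lia.
exists (rcons p y); split; last by apply/spaced_rcons.
- rewrite rcons_path sp /=; suff <- : x = last s p by [].
  by apply: val_inj; rewrite ex nth_track // subn0 nth_last.
- by rewrite size_rcons.
- by rewrite track_rcons.
Qed.

Lemma track_last p : nth n (track p) 0 = val t <-> last s p = t.
Proof.
rewrite nth_track // subn0 (nth_last s (s :: p)) /=.
by split=> [/val_inj|->].
Qed.

Lemma reachP k v : reach E (val s) k v <->
  exists p, [/\ path (@arrow G) s p, size p = k & val (last s p) = v].
Proof.
split.
  elim: k v => [|k IH] v /=; first by move=> ->; exists [::].
  move=> [u /IH[p [sp sz lp]] /EV[x [y [ax ex ey]]]].
  exists (rcons p y); rewrite rcons_path size_rcons last_rcons sp sz ey.
  by have -> : last s p = x by apply: val_inj; rewrite lp ex.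
move=> [p [sp <- <-]]; elim/last_ind: p sp => // p y IH.
rewrite rcons_path size_rcons last_rcons => /andP[sp ay].
by exists (val (last s p)); [apply: IH|apply/EV; exists (last s p), y].
Qed.
End Graph.

(** * The algorithm *)

(** For r >= 2, r + 1 <= r^2 trades the base r + 1 for r at twice the exponent. For r <= 1 the power
    on the right is 1, and r = 1 attains the constant 4. *)
Lemma dimension_bound r K : (r <= 1 -> K = 0) ->
  r.+1 ^ (r + (K + K)) + r + K.+1 <= 4 * maxn 1 r ^ (4 * (r + K)).
Proof.
case: r => [|[|r]] K0; try by rewrite K0.
rewrite (maxn_idPr _) // {K0}.
have lt : r.+2 + K < r.+3 ^ (r.+2 + (K + K)).
  apply: (leq_trans (ltn_expl _ (isT : 1 < r.+3))).
  by rewrite leq_exp2l //; lia.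
have le : r.+3 ^ (r.+2 + (K + K)) <= r.+2 ^ (4 * (r.+2 + K)).
  apply: (@leq_trans ((r.+2 ^ 2) ^ (r.+2 + (K + K)))).
    by rewrite leq_exp2r; lia.
  by rewrite -expnM leq_exp2l //; lia.
by lia.
Qed.

(** The cubic sieve is absorbed by n <= 2m. Since p + 2D <= 18 n^2 D, the search contributes 3000 *
    18; all coefficients together make 60500. *)
Lemma core_time n m l p D : 0 < D -> 1 < n -> n <= 2 * m -> p <= 16 * (n * n) ->
  100 * (n * m) + 200 * (D * D) + 3000 * (n * (n * n)) + 100 * (n * n) +
  3000 * (maxn 1 l * (m * (D * (D * (D * D * (p + D + D)))))) + 100
  <= 70 * 1000 * (D ^ 5 * (maxn 1 l * n ^ 2 * m)).
Proof.
move=> D0 n1 nm pn; rewrite -mulnn; set L := maxn 1 l.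
have L0 : 0 < L by rewrite leq_maxl.
have m0 : 0 < m by lia.
have D5 : D ^ 5 = D * D * (D * D * D) by rewrite !expnS expn0; lia.
have [Z ZE] : exists Z, Z = D ^ 5 * (L * (n * n) * m) by eexists.
have nnm : n * n * m <= Z.
  have -> : Z = D ^ 5 * L * (n * n * m) by rewrite ZE; lia.
  by rewrite leq_pmull // muln_gt0 expn_gt0 D0.
have Dnm : D * D * (n * n * m) <= Z.
  have -> : Z = D * D * D * L * (D * D * (n * n * m)) by rewrite ZE D5; lia.
  by rewrite leq_pmull // !muln_gt0 D0.
have h1 : n * m <= Z by apply: leq_trans nnm; rewrite -mulnA leq_pmull; lia.
have h2 : D * D <= Z by apply: leq_trans Dnm; rewrite leq_pmulr // !muln_gt0; lia.
have h3 : n * (n * n) <= 2 * Z.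
  have : n * (n * n) <= 2 * m * (n * n) by rewrite leq_mul2r nm orbT.
  by lia.
have h4 : n * n <= Z by apply: leq_trans nnm; rewrite leq_pmulr.
have h5 : L * (m * (D * (D * (D * D * (p + D + D))))) <= 18 * Z.
  have : p + D + D <= 18 * (n * n * D).
    have : n * n <= n * n * D by rewrite leq_pmulr.
    have : D <= n * n * D by rewrite leq_pmull // muln_gt0; lia.
    by lia.
  move: (p + D + D) => X Xle.
  have -> : 18 * Z = L * (m * (D * (D * (D * D * (18 * (n * n * D)))))).
    by rewrite ZE D5; lia.
  by rewrite !leq_mul2l Xle !orbT.
have h6 : 0 < Z by apply: leq_trans h1; rewrite muln_gt0; lia.
rewrite -ZE; clear -h1 h2 h3 h4 h5 h6; lia.
Qed.

(** The early answers leave r <= d <= l to the search. Then every solution contains a full window,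
    and its rainbow condition can be checked pair by pair. *)
Definition Main : program :=
  Bfs ;;
  If (Get 3 (Reg 3)) (
    6 ::= Sub (Get 3 (Reg 3)) (Const 1) ;;
    If (Sub (Reg 6) (Reg 5)) (0 ::= Const 0) (
      If (Sub (Reg 4) (Reg 6)) (0 ::= Const 1) (
        Setup ;; Sieve ;; Colors ;; Search ;; 0 ::= Reg 10)))
    (0 ::= Const 0).

(** With at least two vertices, connectivity leaves no vertex isolated, and an arc has only two
    ends. *)
Lemma connected_card (G : digraph) (s t : 'I_(nvert G)) :
  weakly_connected G -> s != t -> nvert G <= 2 * #|arcs G|.
Proof.
move=> wc sNt.
pose S := [set a.1 | a in arcs G] :|: [set a.2 | a in arcs G].
have inS x : x \in S.
  have [y xy] : exists y, x != y.
    by have [e|ne] := eqVneq x s; [exists t; rewrite e|exists s].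
  have /connectP[[|z q]] := wc x y.
    by move=> _ e; rewrite e eqxx in xy.
  rewrite inE /= => /andP[/orP[xz|zx] _] _.
    by apply/orP; left; apply/imsetP; exists (x, z); rewrite ?inE.
  by apply/orP; right; apply/imsetP; exists (z, x); rewrite ?inE.
have : #|S| <= 2 * #|arcs G|.
  apply: leq_trans (leq_card_setU _ _) _.
  by rewrite mul2n -addnn leq_add // leq_imset_card.
have -> : S = [set: 'I_(nvert G)] by apply/setP => x; rewrite inS inE.
by rewrite cardsT card_ord.
Qed.

Lemma lists_arcs_size (G : digraph) (A : seq ('I_(nvert G) * 'I_(nvert G))) :
  lists_arcs A -> size A = #|arcs G|.
Proof. by move=> [/card_uniqP <- AE]; apply: eq_card. Qed.

Lemma wp_Main (G : digraph) (c : 'I_(nvert G) -> nat) (s t : 'I_(nvert G))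
    (r l : nat) (A : seq ('I_(nvert G) * 'I_(nvert G))) :
  weakly_connected G -> s != t -> lists_arcs A ->
  wp Main (input A c s t r l) (fun st T =>
    [/\ locally_rainbow_path c s t r l -> accepting st,
        ~ locally_rainbow_path c s t r l -> rejecting st &
        T <= 70 * 1000 * (4 ^ 5 * maxn 1 r ^ (20 * (r + detour s t l)) *
               (maxn 1 l * nvert G ^ 2 * #|arcs G|))]).
Proof.
move=> wc sNt lA; have nm := connected_card wc sNt; have mE := lists_arcs_size lA.
rewrite -mE in nm *; set m := size A in nm *; set n := nvert G in nm *.
have n1 : 1 < n.
  have := ltn_ord s; have := ltn_ord t; have : val s != val t by [].
  by rewrite -/n => /eqP; rewrite /=; lia.
have [n0 m0] : 0 < n /\ 0 < m by lia.
set st0 := input A c s t r l.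
have [tl tlE] : exists tl, tl = arr st0 0 by eexists.
have [hd hdE] : exists hd, hd = arr st0 1 by eexists.
have [C CE] : exists C, C = arr st0 2 by eexists.
have Cx (x : 'I_n) : C (val x) = c x.
  by rewrite CE /= (nth_map x) ?size_enum_ord // nth_ord_enum.
pose E u v := exists2 j, j < m & tl j = u /\ hd j = v.
have tlhd j : j < m -> exists a, [/\ a \in A, tl j = val a.1 & hd j = val a.2].
  move=> jm; exists (nth (s, s) A j); rewrite mem_nth // tlE hdE /=.
  by rewrite !(nth_map (s, s)).
have EV u v : E u v <-> exists x y : 'I_n, [/\ arrow x y, val x = u & val y = v].
  split=> [[j /tlhd[[x y] [aA e1 e2]] [<- <-]]|[x [y [axy <- <-]]]].
    by exists x, y; split=> //; move: aA; rewrite lA.2 inE.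
  have xyA : (x, y) \in A by rewrite lA.2 inE.
  exists (index (x, y) A); first by rewrite index_mem.
  by rewrite tlE hdE /= !(nth_map (s, s)) ?index_mem // nth_index.
have tlhd_lt j : j < m -> tl j < n /\ hd j < n.
  by move=> /tlhd[a [_ -> ->]]; split; apply: ltn_ord.
have [R1 R1E] : exists R1, R1 = maxn 1 r by eexists.
have R10 : 0 < R1 by rewrite R1E leq_maxl.
set Z := maxn 1 l * n ^ 2 * m.
have Z0 : 0 < Z by rewrite !muln_gt0 leq_maxl n0 m0.
have nmZ : n * m <= Z.
  have -> : Z = maxn 1 l * n * (n * m) by rewrite /Z -mulnn !mulnA.
  by rewrite leq_pmull // muln_gt0 leq_maxl.
rewrite -R1E; set Q := R1 ^ (20 * _).
have Q0 : 0 < Q by rewrite expn_gt0 R10.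
have [a aE] : exists a, a = 4 ^ 5 * Q * Z by eexists.
have aZ : Z <= a by rewrite aE leq_pmull // !muln_gt0 Q0.
rewrite -aE.
apply/wp_seq/wp_conseq.
  exact: (@wp_Bfs st0 n m (val s) tl hd).
move=> st1 T1 ag1 [S1 C1 B1 T1B].
have [i0 i1 i2 i3 i4] : [/\ reg st1 0 = n, reg st1 1 = m, reg st1 2 = val s,
    reg st1 3 = val t & reg st1 4 = r] by rewrite !ag1.1.
have i5 : reg st1 5 = l by rewrite ag1.1.
have [L LE] : exists L, L = arr st1 3 by eexists.
rewrite -LE in S1 C1 B1.
have reP := reachP s EV.
have sizeL p : path (@arrow G) s p -> last s p = t -> size p <= n ->
    0 < L (val t) <= (size p).+1.
  move=> sp lt pn; apply: C1 => //; apply/reP; exists p.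
  by rewrite lt.
apply: wp_if; rewrite /= i3 -LE => Lt; last first.
  apply: wp_set; split=> //=.
  - move=> [p [dp _ _]]; have pn := dipath_size dp.
    case/and3P: dp => sp /eqP lt _.
    by have := sizeL p sp lt (ltnW pn); rewrite Lt.
  - by clear -T1B nmZ aZ Z0; lia.
rewrite -/n -/m in T1B *.
have [d dE] : exists d, L (val t) = d.+1 by exists (L (val t)).-1; rewrite prednK // lt0n.
have [pd [spd szd lpd]] : exists p, [/\ path (@arrow G) s p, size p = d & last s p = t].
  have [p [sp sz lp]] := (reP _ _).1 (S1 _ _ dE).
  by exists p; split=> //; apply: val_inj.
(* [sizeL] reaches only up to length n, but labels are at most n + 1, so d <= n and longer walks are
   no threat. *)
have dmin p : path (@arrow G) s p -> last s p = t -> d <= size p.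
  move=> sp lt; have [pn|/ltnW pn] := leqP (size p) n.
    by have := sizeL p sp lt pn; rewrite dE.
  by apply: leq_trans pn; have := B1 (val t); rewrite dE.
apply/wp_seq/wp_set => /=; rewrite i3 -LE dE subn1 /=.
apply: wp_if => /=; rewrite i5 => ld.
  apply: wp_set; split=> //=.
  - move=> [p [/and3P[sp /eqP lt _] _ pl]]; have := dmin p sp lt; lia.
  - by clear -T1B nmZ aZ Z0; lia.
apply: wp_if => /=; rewrite i4 => rd.
  apply: wp_set; split=> //=.
  - case; have [p dp sz] := shorten_dipath spd lpd.
    exists p; split=> //; last by lia.
    by move=> i /=; lia.
  - by clear -T1B nmZ aZ Z0; lia.
set st2 := set_reg st1 6 d.
apply/wp_seq/wp_conseq; first exact: (@wp_Setup st2 r l d).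
set K := if 1 < r then l - d else 0; set D := r.+1 ^ (r + (K + K)) + r + K.+1.
move=> st3 T3 ag3 [r11 r7 r8 T3B].
have [b0 b1 b2 b5] : [/\ arr st3 0 = tl, arr st3 1 = hd, arr st3 2 = C &
    forall v, arr st3 5 v = 0].
  by rewrite !ag3.2 //= !ag1.2 // tlE hdE CE.
have [b4 b8] : (forall v, arr st3 4 v = 0) /\ (forall v, arr st3 8 v = 0).
  by rewrite !ag3.2 //= !ag1.2.
fr ag3.
apply/wp_seq/wp_conseq; first exact: (@wp_Sieve st3 n).
move=> st4 T4 ag4 [pp np pB T4B]; set p := reg st4 9 in pp np pB T4B.
have rp : reg st4 9 = p by [].
have {}b5 v : arr st4 5 v = 0 by rewrite ag4.2.
have {}b8 v : arr st4 8 v = 0 by rewrite ag4.2.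
fr ag4.
apply/wp_seq/wp_conseq; first exact: (@wp_Colors st4 n C).
move=> st5 T5 ag5 [clE0 cl_n T5B].
have {}b8 v : arr st5 8 v = 0 by rewrite ag5.2.
fr ag5.
have [cl aC] : exists cl, arr st5 5 = cl by eexists.
rewrite aC in clE0 cl_n.
have cl_lt v : v < n -> cl v < n.
  by move=> vn; rewrite clE0 //; case: (last_indexP C vn).
have clE (x y : 'I_n) : cl (val x) = cl (val y) <-> c x = c y.
  have [xn yn] := (ltn_ord x, ltn_ord y).
  rewrite !clE0 // -!Cx; split=> [e|]; last exact: last_index_ext.
  by rewrite -(last_indexP C xn).2 e (last_indexP C yn).2.
have clx (x : 'I_n) : cl (val x) < n by exact: cl_lt (ltn_ord x).
have RD : r.+1 ^ (r + (K + K)) <= D by rewrite /D -addnA leq_addr.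
have RK0 : 0 < r.+1 ^ (r + (K + K)) by rewrite expn_gt0.
have [rD KD] : r < D /\ K < D by rewrite /D; lia.
have r0K : 0 < K -> 0 < r by rewrite /K; case: ifP => // /ltnW.
have Kld : 1 < r -> l - d <= K by rewrite /K => ->.
have un q : 1 < r -> path (@arrow G) s q -> last s q = t -> size q <= l ->
    spaced c s r K (s :: q) -> uniq (s :: q).
  by move=> r1 sq lq ql sd; apply: (spaced_uniq dmin sq lq ql (Kld r1) sd).
have rigid i rs : walk n r K cl E (val s) i rs -> nth n rs 0 = val t ->
    i <= l -> 0 < K -> uniq rs.
  move=> w; have [q [sq <- -> sd]] := walk_path EV clE clx cl_n w.
  move/track_last => lq ql K0; rewrite rev_uniq (map_inj_uniq val_inj).
  by apply: un => //; move: K0; rewrite /K; case: ifP.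
have ctx5 : ctx p n m r K D cl tl hd (val s) (val t) l st5 by split.
apply/wp_seq/wp_conseq.
  exact: (wp_Search pp np rD KD RD r0K (ltn_ord s) (ltn_ord t) sNt tlhd_lt
    cl_lt cl_n rigid ctx5 m0 b8).
move=> st6 T6 ag6 [c01 cE T6B].
have ans : reg st6 10 = 1 <-> locally_rainbow_path c s t r l.
  rewrite cE; split=> [[i [rs [il w h0]]]|[q [dq rb ql]]]; last first.
    have /and3P[sq /eqP lq _] := dq.
    have rq : r <= size q by have := dmin q sq lq; clear -rd; lia.
    exists (size q), (rev [seq val x | x <- s :: q]); split=> //.
      exact: (path_walk EV clE clx cl_n sq (rainbow_spaced K dq rb rq)).
    exact/track_last.
  have [q [sq szq eq sd]] := walk_path EV clE clx cl_n w.
  have lq : last s q = t by apply/track_last; rewrite -eq.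
  (* For r <= 1 the walk may revisit vertices, as K = 0, and is shortened; otherwise [un] makes it a
     path. *)
  rewrite -szq in il; have [r1|r1] := leqP r 1.
    have [q' [dq' rb' qq]] := spaced_shorten r1 sq lq sd.
    by exists q'; split=> //; apply: leq_trans il.
  exists q; split=> //; last exact: spaced_rainbow sd.
  by rewrite /dipath sq lq eqxx un.
apply: wp_set; split=> /=.
- by move/ans.
- by move=> no; case: c01 => // /ans.
have D0 : 0 < D by apply: leq_ltn_trans rD.
have := core_time l D0 n1 nm pB; rewrite -/Z.
have DQ : D ^ 5 * Z <= a.
  rewrite aE leq_mul2r; apply/orP; right.
  (* The fifth power of [dimension_bound] is the origin of the factor 4 ^ 5 and of the 20 in the
     exponent. *)
  apply: (@leq_trans ((4 * R1 ^ (4 * (r + K))) ^ 5)).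
    rewrite leq_exp2r // R1E; apply: dimension_bound.
    by move=> r1; rewrite /K ltnNge r1.
  rewrite expnMn -expnM leq_mul2l /Q leq_pexp2l ?orbT //.
  have := detour_ge l spd lpd (eq_leq szd).
  by rewrite /K; case: ifP => _; clear; lia.
move: (D ^ 5 * Z) DQ => Y DQ.
by rewrite /= in T3B; clear -T1B T3B T4B T5B T6B DQ; lia.
Qed.

Theorem theorem22 :
  exists (P : program) (a b : nat),
  forall (G : digraph) (c : 'I_(nvert G) -> nat) (s t : 'I_(nvert G))
         (r l : nat) (A : seq ('I_(nvert G) * 'I_(nvert G))),
    weakly_connected G -> s != t -> lists_arcs A ->
    exists (st : state) (T : nat),
      [/\ exec P (input A c s t r l) st T,
          locally_rainbow_path c s t r l -> accepting st,
          ~ locally_rainbow_path c s t r l -> rejecting st &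
          T <= a * maxn 1 r ^ (b * (r + detour s t l))
               * (maxn 1 l * nvert G ^ 2 * #|arcs G|)].
Proof.
have [a aE] : exists a, a = 70 * 1000 * 4 ^ 5 by eexists.
exists Main, a, 20 => G c s t r l A wc sNt lA.
have [st [T [ex [yes no TB]]]] := wp_Main c r l wc sNt lA.
by exists st, T; split=> //; rewrite aE -!mulnA; rewrite -!mulnA in TB.
Qed.
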